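(* Let $r,s\ge0$ be integers with $3^r2^s\ge3$. Let $N_{\mathrm{iso}}(r,s)$, $N_{\mathrm{pc}}(r,s)$, $N_{\mathrm{dc}}(r,s)$, $N_{\mathrm{min}}(r,s)$ be the numbers of unordered pairs $\{x,y\}$ of distinct vertices of $B_{r,s}=P_3^{\square r}\square Q_s$ for which $B_{r,s}-\{x,y\}$ is, respectively, an isometric subgraph of $B_{r,s}$, a partial cube, a daisy cube, and a member of $\mathcal O_{\mathrm D}$. Then $$N_{\mathrm{iso}}(r,s)=\iota_{r,s},\quad N_{\mathrm{pc}}(r,s)=\pi_{r,s},\quad N_{\mathrm{dc}}(r,s)=\kappa_{r,s},\quad N_{\mathrm{min}}(r,s)=\omega_{r,s},$$ where $$\iota_{r,s}=\binom{2^{r+s}}{2}-2^{r+s-1}\binom{s}{2}+r2^{r+s},$$ $$\pi_{r,s}=\iota_{r,s}+\mathbf 1_{\{r+s=3\}}\,2^{r+s-1}\binom{s}{2}+\begin{cases}18,&(r,s)=(2,0),\\20,&(r,s)=(1,2),\\29,&(r,s)=(2,1),\\24,&(r,s)=(3,0),\\0,&\text{otherwise},\end{cases}$$ $$\kappa_{r,s}=\begin{cases}3,&(r,s)=(1,0),\\2^{r+s-1}(2^r-1+s),&\text{otherwise},\end{cases}$$ $$\omega_{r,s}=\begin{cases}6,&(r,s)=(1,1),\\2^{r+s-1},&s\ge1,\ 2r+s\ge3,\ (r,s)\ne(1,1),\\0,&\text{otherwise}.\end{cases}$$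
   Context: Graphs are finite and simple; partial cubes are connected by convention. $P_3$ is the path on three vertices, $Q_s$ the hypercube on $\{0,1\}^s$, $\square$ the Cartesian product, $G^{\square0}=Q_0=K_1$. $B_{r,s}-\{x,y\}$ is the subgraph induced by the remaining vertices. $\mathbf 1_{\{r+s=3\}}$ is $1$ if $r+s=3$ and $0$ otherwise. A subgraph $H$ of $G$ is isometric if $d_H(u,v)=d_G(u,v)$ for all $u,v\in V(H)$. A partial cube is a graph isomorphic to an isometric subgraph of a hypercube. A daisy cube is a graph isomorphic to the induced subgraph $Q_n[D]$ for some $n\ge0$ and nonempty down-set $D\subseteq\{0,1\}^n$ (coordinatewise order). In a partial cube, $ab\,\Theta\,uv$ iff $d(a,u)+d(b,v)\ne d(a,v)+d(b,u)$; this is an equivalence relation on edges, and each class ($\Theta$-class) determines two complementary halfspaces $\{z:d(a,z)<d(b,z)\}$, $\{z:d(b,z)<d(a,z)\}$. A restriction of a partial cube is the subgraph induced by a halfspace of a $\Theta$-class; a contraction is obtained by contracting all edges of one $\Theta$-class (suppressing loops and parallel edges). A pc-minor is any graph obtained by a finite sequence of restrictions and contractions; it is proper if not isomorphic to the original graph. $\mathcal O_{\mathrm D}$ is the set of all partial cubes that are not daisy cubes but all of whose proper pc-minors are daisy cubes. *)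

(* Defs.v *)
From HB Require Import structures.
From mathcomp Require Import all_boot.
From mathcomp Require boolp.

Set Implicit Arguments.
Unset Strict Implicit.
Unset Printing Implicit Defensive.

Record sgraph := SGraph {
  vertex :> finType;
  adj : rel vertex;
  adj_sym : symmetric adj;
  adj_irr : irreflexive adj
}.

Definition isomorphic (G H : sgraph) : Prop :=
  exists2 f : G -> H, bijective f & forall u v, adj (f u) (f v) = adj u v.

Definition walk (G : sgraph) (k : nat) (u v : G) : bool :=
  [exists p : k.-tuple G, path (@adj G) u p && (last u p == v)].

(* The least length of a walk from u to v.  A shortest walk has fewer than
   #|G| edges; when u and v are not connected the value is the junk #|G|. *)
Definition dist (G : sgraph) (u v : G) : nat :=
  find (fun k => walk k u v) (iota 0 #|G|).

(* The distance with None standing for infinity. *)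
Definition edist (G : sgraph) (u v : G) : option nat :=
  if connect (@adj G) u v then Some (dist u v) else None.

Record subgraph (G : sgraph) := Subgraph {
  sub_verts : {set G};
  sub_adj : rel G;
  sub_adj_sym : symmetric sub_adj;
  sub_adjP : forall u v, sub_adj u v ->
    [&& u \in sub_verts, v \in sub_verts & adj u v]
}.

Section SubgraphAsGraph.
Variables (G : sgraph) (H : subgraph G).
Let T : finType := {x : G | x \in sub_verts H}.
Let e : rel T := fun u v => sub_adj H (val u) (val v).
Fact subgraph_sym : symmetric e.
Proof. by move=> u v; apply: sub_adj_sym. Qed.
Fact subgraph_irr : irreflexive e.
Proof.
move=> u; apply/negP => /(@sub_adjP _ H) /and3P[_ _].
by rewrite adj_irr.
Qed.
Definition graph_of_subgraph : sgraph := SGraph subgraph_sym subgraph_irr.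
End SubgraphAsGraph.

Coercion graph_of_subgraph : subgraph >-> sgraph.

Section Induced.
Variables (G : sgraph) (A : {set G}).
Let e : rel G := fun u v => [&& u \in A, v \in A & adj u v].
Fact induced_sym : symmetric e.
Proof. by move=> u v; rewrite /e adj_sym andbCA. Qed.
Definition induced : subgraph G :=
  @Subgraph G A e induced_sym (fun u v uv => uv).
End Induced.

Definition delete (G : sgraph) (X : {set G}) : subgraph G := induced (~: X).

(* Since distances may be infinite, an isometric subgraph of a connected graph
   is connected. *)
Definition isometric (G : sgraph) (H : subgraph G) : Prop :=
  forall u v : H, edist u v = edist (val u : G) (val v).

Section Cube.
Variable n : nat.
Let e : rel {ffun 'I_n -> bool} := fun x y => #|[set i | x i != y i]| == 1.
Fact cube_sym : symmetric e.
Proof.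
by move=> x y; congr (#|pred_of_set _| == 1); apply/setP => i; rewrite !inE eq_sym.
Qed.
Fact cube_irr : irreflexive e.
Proof.
move=> x; rewrite /e (_ : [set i | _] = set0) ?cards0 //.
by apply/setP => i; rewrite !inE eqxx.
Qed.
Definition cube : sgraph := SGraph cube_sym cube_irr.
End Cube.

Section Path3.
Let e : rel 'I_3 := fun i j => (i.+1 == j :> nat) || (j.+1 == i :> nat).
Fact path3_sym : symmetric e.
Proof. by move=> i j; rewrite /e orbC. Qed.
Fact path3_irr : irreflexive e.
Proof. by move=> i; rewrite /e orbb gtn_eqF. Qed.
Definition path3 : sgraph := SGraph path3_sym path3_irr.
End Path3.

Section CartesianProduct.
Variables G H : sgraph.
Let e : rel (G * H)%type := fun x y =>
  ((x.1 == y.1) && adj x.2 y.2) || (adj x.1 y.1 && (x.2 == y.2)).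
Fact cart_sym : symmetric e.
Proof.
by move=> x y; rewrite /e (eq_sym x.1) (eq_sym x.2) (adj_sym x.1) (adj_sym x.2).
Qed.
Fact cart_irr : irreflexive e.
Proof. by move=> x; rewrite /e !adj_irr andbF. Qed.
Definition cart : sgraph := SGraph cart_sym cart_irr.
End CartesianProduct.

(* The n-fold Cartesian product of G with itself; for n = 0 it has a single
   vertex. *)
Section CartesianPower.
Variables (G : sgraph) (n : nat).
Let e : rel {ffun 'I_n -> G} := fun x y =>
  [exists i, adj (x i) (y i) && [forall j, (j != i) ==> (x j == y j)]].
Fact cart_pow_sym : symmetric e.
Proof.
move=> x y; apply: eq_existsb => i; rewrite adj_sym; congr andb.
by apply: eq_forallb => j; rewrite (eq_sym (x j)).
Qed.
Fact cart_pow_irr : irreflexive e.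
Proof. by move=> x; rewrite /e; apply/existsP => -[i]; rewrite adj_irr. Qed.
Definition cart_pow : sgraph := SGraph cart_pow_sym cart_pow_irr.
End CartesianPower.

Definition B (r s : nat) : sgraph := cart (cart_pow path3 r) (cube s).

Definition partial_cube (G : sgraph) : Prop :=
  exists n (H : subgraph (cube n)), isometric H /\ isomorphic G H.

Definition down_set (n : nat) (D : {set cube n}) : Prop :=
  forall x y : cube n, (forall i, x i ==> y i) -> y \in D -> x \in D.

Definition daisy_cube (G : sgraph) : Prop :=
  exists n (D : {set cube n}),
    [/\ D != set0, down_set D & isomorphic G (induced D)].

Definition theta (G : sgraph) (a b u v : G) : bool :=
  [&& adj a b, adj u v & dist a u + dist b v != dist a v + dist b u].

(* For an edge ab; the complementary halfspace is [halfspace b a]. *)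
Definition halfspace (G : sgraph) (a b : G) : {set G} :=
  [set z | dist a z < dist b z].

Definition restriction (G : sgraph) (a b : G) : sgraph :=
  induced (halfspace a b).

(* Contraction of the Theta-class of the edge ab: a vertex is a connected
   component of the spanning subgraph formed by the edges of the class. *)
Section Contraction.
Variables (G : sgraph) (a b : G).
Definition blob (u : G) : {set G} := [set v | connect (theta a b) u v].
Let T : finType := {X : {set G} | X \in [set blob u | u : G]}.
Let e : rel T := fun X Y =>
  (X != Y) && [exists u in val X, [exists v in val Y, adj u v]].
Fact contraction_sym : symmetric e.
Proof.
move=> X Y; rewrite /e eq_sym; congr andb.
apply/exists_inP/exists_inP => -[u uX /exists_inP[v vY uv]];
  by exists v => //; apply/exists_inP; exists u; rewrite // adj_sym.
Qed.
Fact contraction_irr : irreflexive e.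
Proof. by move=> X; rewrite /e eqxx. Qed.
Definition contraction : sgraph := SGraph contraction_sym contraction_irr.
End Contraction.

Inductive pc_minor (G : sgraph) : sgraph -> Prop :=
| pc_minor_refl : pc_minor G G
| pc_minor_restriction (H : sgraph) (a b : H) :
    pc_minor G H -> adj a b -> pc_minor G (restriction a b)
| pc_minor_contraction (H : sgraph) (a b : H) :
    pc_minor G H -> adj a b -> pc_minor G (contraction a b).

Definition in_OD (G : sgraph) : Prop :=
  [/\ partial_cube G, ~ daisy_cube G
    & forall H, pc_minor G H -> ~ isomorphic H G -> daisy_cube H].

Definition count_pairs (G : sgraph) (P : {set G} -> Prop) : nat :=
  #|[set X : {set G} | (#|X| == 2) && boolp.asbool (P X)]|.

Definition N_iso (r s : nat) : nat :=
  count_pairs (fun X : {set B r s} => isometric (delete X)).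
Definition N_pc (r s : nat) : nat :=
  count_pairs (fun X : {set B r s} => partial_cube (delete X)).
Definition N_dc (r s : nat) : nat :=
  count_pairs (fun X : {set B r s} => daisy_cube (delete X)).
Definition N_min (r s : nat) : nat :=
  count_pairs (fun X : {set B r s} => in_OD (delete X)).

(* In the next four functions no subtraction is truncated when 0 < r + s: the
   subtracted term of [iota_rs] is at most its first term because
   'C(s, 2) <= 2 ^ s - 1 <= 2 ^ (r + s) - 1. *)
Definition iota_rs (r s : nat) : nat :=
  'C(2 ^ (r + s), 2) - 2 ^ (r + s - 1) * 'C(s, 2) + r * 2 ^ (r + s).

Definition pi_rs (r s : nat) : nat :=
  iota_rs r s + (r + s == 3) * (2 ^ (r + s - 1) * 'C(s, 2))
  + match r, s with
    | 2, 0 => 18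
    | 1, 2 => 20
    | 2, 1 => 29
    | 3, 0 => 24
    | _, _ => 0
    end.

Definition kappa_rs (r s : nat) : nat :=
  if (r, s) == (1, 0) then 3 else 2 ^ (r + s - 1) * (2 ^ r - 1 + s).

Definition omega_rs (r s : nat) : nat :=
  if (r, s) == (1, 1) then 6
  else if (1 <= s) && (3 <= 2 * r + s) then 2 ^ (r + s - 1)
  else 0.

(* Main.v *)
(** Write P_3 as {10, 00, 01}, so that B_{r,s} is an isometric subset of a
    hypercube, closed under turning 1 into 0 in the P_3-coordinates.  A partial
    cube with a fixed isometric embedding is a daisy cube iff some vertex o is the
    minimum of a down-set: flipping any coordinate of any vertex towards o stays
    inside.  Restrictions and contractions are read off the embedding, so daisy
    cubes are closed under pc-minors.

    Deleting {x, y} is isometric iff no two vertices at distance 2 lose all their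
    common neighbours.  In the daisy case o must be the middle vertex in all
    P_3-coordinates and opposite to x and y in the others, which forces x and y to
    agree in Q_s, or to be neighbours there.  The antipodal pairs of corners are the
    minimal ones: otherwise a shared coordinate can be restricted away, and every
    restriction or contraction of an antipodal deletion is a down-set.

    If B_{r,s} - {x, y} is a partial cube and r + s >= 4, the edges of each direction
    of B_{r,s} all lie in one Theta-class: opposite edges of 4-cycles do, and a product
    of three factors minus two vertices is connected.  Hence distances in the
    deletion are at most those in B_{r,s}, and it is isometric.  The cases r + s <= 3
    are decided by a verified computation: explicit embeddings on the positive side,
    disconnected graphs or pairs of edges violating the transitivity of Theta on the
    negative side, and non-daisy contractions for the sporadic partial cubes. *)

Require Import Defs.
From mathcomp Require Import all_boot.
From mathcomp Require boolp.
From mathcomp Require Import zify.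

Set Implicit Arguments.
Unset Strict Implicit.
Unset Printing Implicit Defensive.

(** * Distances and Hamming embeddings *)

(** Isometry is not handled through distances: [embeds] asks for one step towards every target, so
    each claim about a deletion, restriction or contraction reduces to rerouting a single step.
    Being a star centre depends on the embedding, but [daisy_star_center] yields one for every
    embedding of a daisy cube; this is why the one embedding [code], with its projections, suffices
    to refute daisiness.

    The threshold of four factors comes from fixing one direction: its edges correspond to the
    vertices of a product of the remaining factors, from which at most two are removed. Three
    factors stay connected, whereas two opposite vertices separate [Q_2].

    Non-isometric partial cubes among the small deletions could disturb the counts of daisy and of
    minimal deletions. One non-daisy contraction excludes such a graph from both: daisy cubes are
    closed under contraction, and a contraction is a proper minor. *)

Lemma isomorphic_card (G H : sgraph) : isomorphic G H -> #|G| = #|H|.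
Proof. by case=> f /bij_eq_card. Qed.

Lemma walkP (G : sgraph) k (u v : G) :
  reflect (exists2 p, path (@adj G) u p & last u p = v /\ size p = k)
          (walk k u v).
Proof.
apply: (iffP existsP) => [[p /andP[pp /eqP lp]]|[p pp [lp sp]]].
  by exists p => //; rewrite size_tuple.
by exists (tcast sp (in_tuple p)); rewrite val_tcast /= pp lp eqxx.
Qed.

(** [dist] searches only lengths below [#|G|]. A walk shortened to distinct vertices shows that the
    minimal length lies in that range. *)
Lemma dist_eq (G : sgraph) (u v : G) (p : seq G) :
  path (@adj G) u p -> last u p = v ->
  (forall q, path (@adj G) u q -> last u q = v -> size p <= size q) ->
  dist u v = size p.
Proof.
move=> pp lp min_p; have [p' pp' [up' lp']] : exists2 q, path (@adj G) u q &
    uniq (u :: q) /\ last u q = v.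
  by move: lp; case: (shortenP pp) => q pq uq _ <-; exists q.
have lt_p : size p < #|G|.
  apply: leq_ltn_trans (min_p _ pp' lp') _.
  by rewrite -[(size p').+1]/(size (u :: p')) -(card_uniqP up') max_card.
rewrite /dist; set a := (fun k => walk k u v).
have ap : a (size p) by apply/walkP; exists p.
have ha : has a (iota 0 #|G|).
  by apply/hasP; exists (size p) => //; rewrite mem_iota.
apply/eqP; rewrite eqn_leq; apply/andP; split.
  rewrite leqNgt; apply/negP => /(before_find 0).
  by rewrite nth_iota // add0n ap.
have := nth_find 0 ha; rewrite nth_iota ?add0n;
  last by rewrite -{2}(size_iota 0 #|G|) -has_find.
by case/walkP => q pq [lq <-]; apply: min_p.
Qed.

Lemma dist_walk (G : sgraph) (u v : G) : connect (@adj G) u v ->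
  exists2 p, path (@adj G) u p & last u p = v /\ size p = dist u v.
Proof.
move=> /connectP[p0 pp0 lp0].
have ex : exists k, walk k u v by exists (size p0); apply/walkP; exists p0.
case: (ex_minnP ex) => k /walkP[p pp [lp sp]] kmin.
exists p => //; split=> //; symmetry; apply: dist_eq => // q pq lq.
by rewrite sp; apply: kmin; apply/walkP; exists q.
Qed.

Lemma dist_le (G : sgraph) (u v : G) (p : seq G) :
  path (@adj G) u p -> last u p = v -> dist u v <= size p.
Proof.
move=> pp lp; have ex : exists k, walk k u v by exists (size p); apply/walkP;
  exists p.
case: (ex_minnP ex) => k /walkP[q pq [lq sq]] kmin.
have mink r : path (@adj G) u r -> last u r = v -> k <= size r.
  by move=> pr lr; apply: kmin; apply/walkP; exists r.
by rewrite (dist_eq pq lq) ?sq; [apply: mink|].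
Qed.

(** Descending by the third hypothesis gives a walk of length [d v], and the second makes every walk
    at least that long. This criterion computes distances in an embedded graph and is also what
    [row_ok] checks. *)
Lemma dist_unique (G : sgraph) (a : G) (d : G -> nat) :
  d a = 0 ->
  (forall u v, adj u v -> d v <= (d u).+1) ->
  (forall v, v != a -> exists2 u, adj u v & d v = (d u).+1) ->
  forall v, connect (@adj G) a v /\ dist a v = d v.
Proof.
move=> da dS dP v.
have [p pp [lp sp]] : exists2 p, path (@adj G) a p & last a p = v /\ size p = d v.
  have [n] := ubnP (d v); elim: n v => // n IH v; rewrite ltnS => le_n.
  have [->|vNa] := eqVneq v a; first by exists [::].
  have [u uv duv] := dP v vNa.
  have [|p pp [lp sp]] := IH u; first by rewrite -duv.
  by exists (rcons p v); rewrite ?rcons_path ?last_rcons ?size_rcons ?pp ?lp ?sp.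
split; first by apply/connectP; exists p.
rewrite (dist_eq pp lp) // => q pq lq; rewrite sp -lq -[size q]addn0 -da addnC.
elim/last_ind: q pq {lq} => [|q x IH]; first by rewrite addn0.
rewrite rcons_path last_rcons size_rcons addnS => /andP[pq /dS h].
by apply: leq_trans h _; rewrite ltnS IH.
Qed.

Section Hamming.
Variable I : finType.
Implicit Types u v w : {ffun I -> bool}.

Definition flip k u : {ffun I -> bool} := [ffun i => (i == k) (+) u i].
Definition ham u v := #|[set i | u i != v i]|.

Lemma flipE k u i : flip k u i = (i == k) (+) u i.
Proof. by rewrite ffunE. Qed.

Lemma flip_at k u : flip k u k = ~~ u k.
Proof. by rewrite flipE eqxx. Qed.

Lemma flip_neq k u i : i != k -> flip k u i = u i.
Proof. by rewrite flipE => /negbTE->. Qed.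

Lemma flipK k : involutive (flip k).
Proof. by move=> u; apply/ffunP => i; rewrite !flipE addbA addbb. Qed.

Lemma flip_inj k : injective (flip k). Proof. exact: inv_inj (flipK k). Qed.

Lemma flipC k l u : flip k (flip l u) = flip l (flip k u).
Proof. by apply/ffunP => i; rewrite !flipE addbCA. Qed.

Lemma flip_neq_self k u : flip k u != u.
Proof. by apply/eqP => /ffunP/(_ k); rewrite flip_at; case: (u k). Qed.

Lemma flip_key k l u : flip k u = flip l u -> k = l.
Proof.
move=> /ffunP/(_ k); rewrite flip_at; have [//|kl] := eqVneq k l.
by rewrite flip_neq //; case: (u k).
Qed.

Lemma hamC u v : ham u v = ham v u.
Proof. by apply: eq_card => i; rewrite !inE eq_sym. Qed.

Lemma ham0 u : ham u u = 0.
Proof. by apply: eq_card0 => i; rewrite !inE eqxx. Qed.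

Lemma ham_eq0 u v : (ham u v == 0) = (u == v).
Proof.
apply/idP/eqP => [|->]; last by rewrite ham0.
rewrite cards_eq0 => /eqP/setP uv; apply/ffunP => i.
by have := uv i; rewrite !inE => /negbFE/eqP.
Qed.

Lemma ham_flip k u v : u k != v k -> ham u v = (ham (flip k u) v).+1.
Proof.
move=> uvk; rewrite /ham (cardsD1 k) inE uvk add1n; congr _.+1.
apply: eq_card => i; rewrite !inE flipE; case: eqVneq => [->|_] //=.
by move: uvk; case: (u k); case: (v k).
Qed.

Lemma ham_flipN k u v : u k = v k -> ham (flip k u) v = (ham u v).+1.
Proof.
move=> uvk; rewrite (@ham_flip k) ?flipK // flip_at uvk.
by case: (v k).
Qed.

Lemma ham_flip_lt k u v : (ham (flip k u) v < ham u v) = (u k != v k).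
Proof.
have [uvk|uvk] := eqVneq (u k) (v k); last by rewrite (ham_flip uvk) ltnS leqnn.
by rewrite ham_flipN // ltnNge leqnSn.
Qed.

Lemma ham1P u v : reflect (exists k, v = flip k u) (ham u v == 1).
Proof.
apply: (iffP cards1P) => [[k /setP kE]|[k ->]]; exists k.
  apply/ffunP => i; rewrite flipE; have := kE i; rewrite !inE.
  by case: (i == k); case: (u i); case: (v i).
apply/setP => i; rewrite !inE flipE.
by case: (i == k); case: (u i).
Qed.

Lemma neq_ffun u v : u != v -> exists k, u k != v k.
Proof.
move=> uv; apply/existsP; apply: contraR uv; rewrite negb_exists => /forallP h.
by apply/eqP/ffunP => k; apply/eqP; have := h k; rewrite negbK.
Qed.
End Hamming.

(** An isometric embedding in local form: iterating [emb_step] gives a geodesic of Hamming length.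
    The index type is arbitrary, so that the directions of a product can be named by its factors. *)
Record embeds (I : finType) (G : sgraph) (f : G -> {ffun I -> bool}) : Prop :=
  Embeds {
  emb_adj : forall u v, adj u v <-> exists k, f v = flip k (f u);
  emb_step : forall u v, u != v -> exists k w,
    f u k != f v k /\ f w = flip k (f u)
}.

Lemma cube_adjP n (u v : cube n) : adj u v <-> exists k, v = flip k u.
Proof. by split=> /ham1P. Qed.

Lemma embeds_cube n : embeds (fun u : cube n => u).
Proof.
split; first exact: cube_adjP.
by move=> u v /neq_ffun[k uvk]; exists k, (flip k u).
Qed.

Section Embedding.
Variables (I : finType) (G : sgraph) (f : G -> {ffun I -> bool}).
Hypothesis ef : embeds f.

Lemma emb_inj : injective f.
Proof.
move=> u v fuv; apply/eqP; apply/negP => /negP/(emb_step ef)[k [w []]].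
by rewrite fuv eqxx.
Qed.

Lemma emb_dist u v : connect (@adj G) u v /\ dist u v = ham (f u) (f v).
Proof.
move: v; apply: dist_unique => [|x y|x xu]; first exact: ham0.
- case/(emb_adj ef) => k ->; rewrite ![ham (f u) _]hamC.
  have [e|e] := eqVneq (f x k) (f u k); first by rewrite ham_flipN.
  by rewrite [X in _ <= X.+1](ham_flip e) ltnW.
- have [k [w [xuk wE]]] := emb_step ef xu.
  exists w; first by rewrite adj_sym; apply/(emb_adj ef); exists k.
  by rewrite hamC (ham_flip xuk) -wE hamC.
Qed.

Lemma emb_connect u v : connect (@adj G) u v. Proof. by case: (emb_dist u v). Qed.
Lemma emb_distE u v : dist u v = ham (f u) (f v). Proof. by case: (emb_dist u v). Qed.

Lemma emb_flip u v k : f v = flip k (f u) -> adj u v.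
Proof. by move=> e; apply/(emb_adj ef); exists k. Qed.

End Embedding.

Section EmbedSubgraph.
Variables (I : finType) (G : sgraph) (f : G -> {ffun I -> bool}).
Hypothesis ef : embeds f.

Lemma isometric_embeds (H : subgraph G) :
  isometric H -> embeds (fun u : H => f (val u)).
Proof.
move=> isoH; have cd (u v : H) :
    connect (@adj H) u v /\ dist u v = ham (f (val u)) (f (val v)).
  have := isoH u v; rewrite /edist (emb_connect ef) (emb_distE ef).
  by case: connect => // -[->].
split=> u v.
  split=> [/= uv|[k kE]].
    by apply/(emb_adj ef); case/(@sub_adjP _ H)/and3P: uv.
  have [c d] := cd u v; have [p pp [lp]] := dist_walk c.
  rewrite d kE hamC (@ham_flip _ k) ?flip_at ?flipK ?ham0; last by case: (f _ k).
  by case: p pp lp => [|x [|//]] //= /andP[ux _] <-.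
move=> uv; have [c d] := cd u v.
have [[|w p] pp [lw sw]] := dist_walk c; first by rewrite -lw eqxx in uv.
have /andP[uw pw] := pp.
have : adj (val u) (val w) by case/(@sub_adjP _ H)/and3P: uw.
case/(emb_adj ef) => k wE; exists k, w; split=> //.
rewrite -ham_flip_lt -wE -d -sw ltnS; have [_ <-] := cd w v.
exact: (@dist_le H _ _ _ pw lw).
Qed.

Variable A : {set G}.
Let fA : induced A -> {ffun I -> bool} := fun u => f (val u).

Lemma induced_adj (u v : induced A) : adj u v = adj (val u) (val v).
Proof. by rewrite /= (valP u) (valP v). Qed.

Lemma embeds_induced :
  (forall u v, u \in A -> v \in A -> u != v -> exists k w,
     [/\ w \in A, f u k != f v k & f w = flip k (f u)]) ->
  embeds fA.
Proof.
move=> stepA; split=> u v; first by rewrite induced_adj; apply: (emb_adj ef).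
move=> uv; have [//|k [w [wA uvk wE]]] := stepA _ _ (valP u) (valP v).
by exists k, (Sub w wA).
Qed.

Lemma isometric_induced : isometric (induced A) <-> embeds fA.
Proof.
split=> [/isometric_embeds//|eA u v].
by rewrite /edist (emb_connect ef) (emb_distE ef) (emb_connect eA) (emb_distE eA).
Qed.
End EmbedSubgraph.

(** * Partial cubes and daisy cubes *)

Lemma embeds_isomorphic (I : finType) (G H : sgraph) (g : G -> H)
    (f : H -> {ffun I -> bool}) :
  bijective g -> (forall u v, adj (g u) (g v) = adj u v) -> embeds f ->
  embeds (fun u => f (g u)).
Proof.
move=> gbij gadj ef; have [h gK hK] := gbij; split=> u v.
  by rewrite -gadj; apply: (emb_adj ef).
rewrite -(inj_eq (bij_inj gbij)) => /(emb_step ef)[k [w [uvk wE]]].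
by exists k, (h w); rewrite hK.
Qed.

Lemma isomorphic_image (G : sgraph) n (h : G -> cube n) : injective h ->
  (forall u v, adj (h u) (h v) = adj u v) ->
  isomorphic G (induced [set h u | u : G]).
Proof.
move=> hinj hadj.
have hin u : h u \in [set h u | u : G] by apply: imset_f.
exists (fun u => Sub (h u) (hin u) : induced [set h u | u : G]).
  apply: inj_card_bij => [u v [/hinj//]|].
  by rewrite card_sig; apply: leq_trans (leq_imset_card h G); apply: eq_leq;
    apply: eq_card.
by move=> u v; rewrite induced_adj hadj.
Qed.

Lemma partial_cube_embeds G : partial_cube G ->
  exists n (f : G -> {ffun 'I_n -> bool}), embeds f.
Proof.
case=> n [H [isoH [g gbij gadj]]]; exists n, (fun u => val (g u)).
exact: (embeds_isomorphic gbij gadj (isometric_embeds (embeds_cube n) isoH)).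
Qed.

Section Reindex.
Variables (I : finType) (G : sgraph) (f : G -> {ffun I -> bool}).

Definition reindex (u : {ffun I -> bool}) : cube #|I| :=
  [ffun i => u (enum_val i)].

Lemma reindex_inj : injective reindex.
Proof.
move=> u v /ffunP uv; apply/ffunP => k.
by have := uv (enum_rank k); rewrite !ffunE enum_rankK.
Qed.

Lemma reindex_flip k u : reindex (flip k u) = flip (enum_rank k) (reindex u).
Proof.
apply/ffunP => i; rewrite !ffunE.
by rewrite -(inj_eq enum_rank_inj) enum_valK.
Qed.

Lemma embeds_reindex : embeds f -> embeds (fun u => reindex (f u)).
Proof.
move=> ef; split=> u v.
  rewrite (emb_adj ef); split=> [[k ->]|[i]]; first by exists (enum_rank k);
    rewrite reindex_flip.
  by rewrite -(enum_valK i) -reindex_flip => /reindex_inj; exists (enum_val i).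
case/(emb_step ef) => k [w [uvk wE]].
by exists (enum_rank k), w; rewrite wE reindex_flip !ffunE enum_rankK.
Qed.
End Reindex.

Lemma embeds_partial_cube (I : finType) (G : sgraph) (f : G -> {ffun I -> bool}) :
  embeds f -> partial_cube G.
Proof.
move=> /embeds_reindex; set h : G -> cube #|I| := (fun u => _) => eh.
have hinj := emb_inj eh.
have hadj u v : adj (h u) (h v) = adj u v.
  by apply/idP/idP; rewrite (emb_adj eh) => /cube_adjP.
exists #|I|, (induced [set h u | u : G]); split; last exact: isomorphic_image.
apply/(isometric_induced (embeds_cube _)).
refine (embeds_induced (embeds_cube _) _) => _ _ /imsetP[u _ ->] /imsetP[v _ ->].
rewrite (inj_eq hinj) => /(emb_step eh)[k [w [uvk wE]]].
by exists k, (h w); rewrite imset_f.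
Qed.

(** If [u] is below [v], raising a missing coordinate stays below [v]; otherwise [u] has a
    coordinate that [v] lacks, and lowering it stays below [u]. *)
Lemma embeds_down_set n (D : {set cube n}) : down_set D ->
  embeds (fun u : induced D => val u : {ffun 'I_n -> bool}).
Proof.
move=> dD; refine (embeds_induced (embeds_cube n) _) => u v uD vD uv.
have [/forallP le_uv|] := boolP [forall i, u i ==> v i].
  have [k uvk] := neq_ffun uv; exists k, (flip k u); split=> //.
  apply: (dD _ v) => // i; have := le_uv i.
  by rewrite flipE; case: (eqVneq i k) => [->|//]; move: uvk; case: (u k);
    case: (v k).
rewrite negb_forall => /existsP[k]; rewrite negb_imply => /andP[uk vk].
exists k, (flip k u); rewrite uk (negbTE vk); split=> //.
by apply: (dD _ u) => // i; rewrite flipE; case: (eqVneq i k) => [->|_];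
  rewrite ?uk ?implybT ?implybb.
Qed.

Lemma daisy_partial_cube G : daisy_cube G -> partial_cube G.
Proof.
case=> n [D [_ dD [g gbij gadj]]].
exact: embeds_partial_cube (embeds_isomorphic gbij gadj (embeds_down_set dD)).
Qed.

(* Once the coordinates are flipped so that f o becomes 0, the image of f is a
   down-set. *)
Definition star_center (I : finType) (G : sgraph) (f : G -> {ffun I ->
  bool}) (o : G) :=
  forall v k, f v k != f o k -> exists w, f w = flip k (f v).

Section StarCenter.
Variables (I : finType) (G : sgraph) (f : G -> {ffun I -> bool}).
Hypothesis ef : embeds f.

(* In a down-set a vertex v has dist o v neighbours closer to the minimum o, and
   every isometric embedding has room for at most that many. *)
Lemma daisy_star_center : daisy_cube G -> exists o, star_center f o.
Proof.
case=> n [D [D0 dD [g gbij gadj]]].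
have eg := embeds_isomorphic gbij gadj (embeds_down_set dD).
have [h gK hK] := gbij.
have [d0 d0D] := set0Pn _ D0.
have botD : [ffun=> false] \in D by apply: (dD _ d0) => // i; rewrite ffunE.
pose o : G := h (Sub [ffun=> false] botD).
have go : val (g o) = [ffun=> false] by rewrite hK.
exists o => v k vok; pose T := [set i | val (g v) i != val (g o) i].
have down i : exists w, (i \in T) ==> (val (g w) == flip i (val (g v))).
  have [iT|] := boolP (i \in T); last by exists o.
  have wD : flip i (val (g v)) \in D.
    apply: (dD _ (val (g v))) (valP (g v)) => j; rewrite flipE.
    case: (eqVneq j i) => [->|_]; last by rewrite implybb.
    by move: iT; rewrite inE go ffunE; case: (sval (g v) i).
  by exists (h (Sub (flip i (val (g v))) wD)); rewrite hK SubK eqxx implybT.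
pose wt i := xchoose (down i).
have wtE i : i \in T -> val (g (wt i)) = flip i (val (g v)).
  by move=> iT; have /implyP/(_ iT)/eqP := xchooseP (down i).
have key i : exists l, (i \in T) ==> (f (wt i) == flip l (f v)).
  have [iT|] := boolP (i \in T); last by exists k.
  have : adj v (wt i) by apply/(emb_adj eg); exists i; rewrite wtE.
  by case/(emb_adj ef) => l ->; exists l; rewrite eqxx.
pose kt i := xchoose (key i).
have ktE i : i \in T -> f (wt i) = flip (kt i) (f v).
  by move=> iT; have /implyP/(_ iT)/eqP := xchooseP (key i).
have kt_inj : {in T &, injective kt}.
  move=> i j iT jT eij; have /(emb_inj ef) wij : f (wt i) = f (wt j) by rewrite (ktE i iT) (ktE j jT) eij.
  by have := wtE i iT; rewrite wij (wtE j jT) => /flip_key/esym.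
have subT : kt @: T \subset [set l | f v l != f o l].
  apply/subsetP => _ /imsetP[i iT ->]; rewrite inE -ham_flip_lt -(ktE i iT).
  rewrite -!(emb_distE ef) !(emb_distE eg) (wtE i iT) ham_flip_lt.
  by move: iT; rewrite inE.
(* Both sets have [dist o v] elements, one computed in the down-set and the other under [f], so the
   inclusion is an equality. *)
have /eqP/setP/(_ k) : kt @: T == [set l | f v l != f o l].
  rewrite eqEcard subT card_in_imset //.
  by rewrite -/(ham (f v) (f o)) -(emb_distE ef) (emb_distE eg); apply: leqnn.
by rewrite inE vok => /imsetP[i iT ->]; exists (wt i); rewrite (ktE i iT).
Qed.

(** The full down-set property: after translating [f o] to 0, the vectors [c] are those below [f v].
    Single flips towards [o] reach them by induction on the Hamming distance. *)
Lemma star_centerW o v (c : {ffun I -> bool}) : star_center f o ->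
  (forall i, c i = f v i \/ c i = f o i) -> exists w, f w = c.
Proof.
move=> so; have [n] := ubnP (ham (f v) c); elim: n v => // n IH v.
rewrite ltnS => le_n cP; have [<-|vc] := eqVneq (f v) c; first by exists v.
have [k vck] := neq_ffun vc.
have cok : c k = f o k by case: (cP k) => // e; rewrite e eqxx in vck.
have [|w wE] := so v k; first by rewrite -cok.
apply: (IH w); first by apply: leq_trans le_n; rewrite wE ham_flip_lt.
move=> i; rewrite wE flipE; case: eqVneq => [->|_] /=; last exact: cP.
by right.
Qed.

Lemma star_center_daisy o : star_center f o -> daisy_cube G.
Proof.
move=> so; pose h (u : G) : cube #|I| := reindex [ffun k => f u k (+) f o k].
have xorI : injective (fun c : {ffun I -> bool} => [ffun k => c k (+) f o k]).
  move=> c d /ffunP e; apply/ffunP => k; have := e k.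
  by rewrite !ffunE; apply: addIb.
have hinj : injective h by move=> u v /reindex_inj/xorI/(emb_inj ef).
have xor_flip k c : [ffun i => flip k c i (+) f o i] =
    flip k [ffun i => c i (+) f o i].
  by apply/ffunP => i; rewrite !ffunE addbA.
exists #|I|, [set h u | u : G]; split.
- by apply/set0Pn; exists (h o); apply: imset_f.
- move=> c d le_cd /imsetP[v _ dE].
  pose c' : {ffun I -> bool} := [ffun k => c (enum_rank k) (+) f o k].
  have [i|w wE] := @star_centerW o v c' so.
    have := le_cd (enum_rank i); rewrite dE !ffunE enum_rankK.
    by case: (c _) (f v i) (f o i) => [] [] [] //= _; auto.
  apply/imsetP; exists w => //; apply/ffunP => i.
  by rewrite !ffunE wE ffunE enum_valK -addbA addbb addbF.
apply: isomorphic_image => // u v; apply/idP/idP.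
  case/cube_adjP => i /esym; rewrite -(enum_valK i) /h -reindex_flip => /reindex_inj.
  by rewrite -xor_flip => /xorI e; apply: (emb_flip ef (esym e)).
by case/(emb_adj ef) => k kE; apply/cube_adjP; exists (enum_rank k);
  rewrite /h -reindex_flip kE xor_flip.
Qed.
End StarCenter.

(** * Restrictions and contractions *)

Section Minors.
Variables (I : finType) (G : sgraph) (f : G -> {ffun I -> bool}).
Hypothesis ef : embeds f.
Variables (a b : G) (k : I).
Hypothesis fb : f b = flip k (f a).

Lemma halfspaceE : halfspace a b = [set z | f z k == f a k].
Proof.
apply/setP => z; rewrite !inE !(emb_distE ef) fb [f z k == _]eq_sym.
have [e|e] := eqVneq (f a k) (f z k); first by rewrite ham_flipN // ltnSn.
by rewrite [ham (f a) _](ham_flip e) ltnNge leqnSn.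
Qed.

Lemma halfspaceP z : reflect (f z k = f a k) (z \in halfspace a b).
Proof. by rewrite halfspaceE inE; apply: eqP. Qed.

Lemma embeds_restriction : embeds (fun u : restriction a b => f (val u)).
Proof.
apply: embeds_induced ef _ _ => u v /halfspaceP uk /halfspaceP vk.
case/(emb_step ef) => l [w [uvl wE]]; exists l, w; split=> //.
apply/halfspaceP; rewrite wE flip_neq //.
by apply/eqP => kl; rewrite -kl uk vk eqxx in uvl.
Qed.

Lemma card_restriction : #|restriction a b| < #|G|.
Proof.
have bN : b \notin halfspace a b by apply/halfspaceP; rewrite fb flip_at;
  case: (f a k).
have : halfspace a b \proper [set: G].
  by rewrite properT; apply: contraNneq bN => ->; rewrite inE.
by move/proper_card; rewrite cardsT card_sig.
Qed.

Lemma daisy_restriction o : star_center f o -> daisy_cube (restriction a b).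
Proof.
(* The centre may lie in the other halfspace. Its copy on this side is a vertex, because it mixes
   the coordinates of [a] and [o]. *)
move=> so; have [o' [o'k o'E]] : exists o', f o' k = f a k /\
    forall l, l != k -> f o' l = f o l.
  pose c : {ffun I -> bool} := [ffun i => if i == k then f a k else f o i].
  have [i|w wE] := @star_centerW _ _ f o a c so.
    by rewrite ffunE; case: eqVneq => [->|_]; auto.
  by exists w; rewrite wE ffunE eqxx; split=> // l /negbTE lk; rewrite ffunE lk.
have o'H : o' \in halfspace a b by apply/halfspaceP.
apply: (star_center_daisy embeds_restriction (o := Sub o' o'H)) => -[v vH] l /=.
have vk := halfspaceP _ vH; have [->|lk] := eqVneq l k; first by rewrite vk o'k eqxx.
rewrite o'E // => /so[w wE]; have wH : w \in halfspace a b.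
  by apply/halfspaceP; rewrite wE flip_neq // eq_sym.
by exists (Sub w wH).
Qed.

(** Setting the coordinate to [false] instead of removing it keeps the index type, so a contraction
    is embedded with the same directions. *)
Definition proj (c : {ffun I -> bool}) : {ffun I -> bool} :=
  [ffun i => (i != k) && c i].

Lemma proj_eq u v : proj u = proj v <-> (forall l, l != k -> u l = v l).
Proof.
split=> [/ffunP e l lk|e]; first by have := e l; rewrite !ffunE lk.
by apply/ffunP => l; rewrite !ffunE; have [//|/e] := eqVneq l k.
Qed.

Lemma proj_flip c : proj (flip k c) = proj c.
Proof. by apply/proj_eq => l lk; rewrite flip_neq. Qed.

Lemma proj_flip_neq l c : l != k -> proj (flip l c) = flip l (proj c).
Proof.
move=> lk; apply/ffunP => i; rewrite !ffunE.
by have [->|_] := eqVneq i l; rewrite ?lk.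
Qed.

Lemma proj_eq_flip u v : proj u = proj v -> v = u \/ v = flip k u.
Proof.
move=> /proj_eq e; have [ek|ek] := eqVneq (u k) (v k); [left|right].
  by apply/ffunP => i; have [->|/e] := eqVneq i k.
apply/ffunP => i; rewrite flipE; have [->|/e] := eqVneq i k => //.
by move: ek; case: (u k); case: (v k).
Qed.

(** For an edge in a direction other than [k], both of its ends lie on the same side of [ab], and
    the two sums agree; in direction [k] they differ by 2. *)
Lemma thetaE u v : theta a b u v = (f v == flip k (f u)).
Proof.
have ab := emb_flip ef fb; rewrite /theta ab /=.
have [uv|] := boolP (adj u v); last first.
  by move/negP=> uv; symmetry; apply/negP => /eqP/(emb_flip ef).
have [l lE] := (emb_adj ef u v).1 uv; rewrite /= !(emb_distE ef) fb lE.
have [e|kl] := eqVneq l k; last first.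
  have -> : (flip l (f u) == flip k (f u)) = false.
    by apply/eqP => /flip_key e; rewrite e eqxx in kl.
  apply/negbTE; rewrite negbK; have fl : flip l (f u) k = f u k by rewrite flip_neq // eq_sym.
  have [e|e] := eqVneq (f a k) (f u k).
    by rewrite !ham_flipN ?fl //; lia.
  by rewrite [ham (f a) (flip _ _)](@ham_flip _ k) ?fl // [ham (f a) (f u)](@ham_flip _ k) //; lia.
rewrite -e eqxx.
have flipl x y : ham (flip l x) (flip l y) = ham x y.
  by apply: eq_card => i; rewrite !inE !flipE (inj_eq (@addbI _)).
rewrite flipl [ham (f a) (flip _ _)]hamC -[ham _ (f a)]flipl flipK [ham _ (flip _ _)]hamC.
have [e'|e'] := eqVneq (f a l) (f u l); first by rewrite ham_flipN //; lia.
by rewrite [ham (f a) _](ham_flip e'); lia.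
Qed.

(** A fibre of [proj] has at most two vertices, and two vertices in it are joined by an edge of the
    class. *)
Lemma blobP u v : reflect (proj (f u) = proj (f v)) (v \in blob a b u).
Proof.
rewrite inE; apply: (iffP connectP) => [[p pp ->]|].
  elim: p u pp => //= x p IH u /andP[]; rewrite thetaE => /eqP e /IH <-.
  by rewrite e proj_flip.
case/proj_eq_flip => [/(emb_inj ef)->|e]; first by exists [::].
by exists [:: v]; rewrite //= thetaE e eqxx.
Qed.

Lemma blob_eq u v : blob a b u = blob a b v <-> proj (f u) = proj (f v).
Proof.
split=> [e|e]; first by apply/blobP; rewrite e; apply/blobP.
by apply/setP => w; apply/blobP/blobP; rewrite e.
Qed.

Fact blob_in u : blob a b u \in [set blob a b u | u : G].
Proof. exact: imset_f. Qed.

Definition to_blob (u : G) : contraction a b := exist _ (blob a b u) (blob_in u).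

Lemma to_blobP (X : contraction a b) : exists u, X = to_blob u.
Proof.
by case: X => X XP; case/imsetP: (XP) => u _ XE; exists u; apply: val_inj.
Qed.

Lemma to_blob_eq u v : to_blob u = to_blob v <-> proj (f u) = proj (f v).
Proof.
rewrite -blob_eq; split=> [/(congr1 val)//|e]; exact: val_inj.
Qed.

(** A blob comes without a chosen vertex. By [to_blobP] the default branch is never reached, and
    [fconE] shows that the choice is immaterial. *)
Definition fcon (X : contraction a b) : {ffun I -> bool} :=
  if [pick u | X == to_blob u] is Some u then proj (f u) else proj (f a).

Lemma fconE u : fcon (to_blob u) = proj (f u).
Proof.
rewrite /fcon; case: pickP => [v /eqP/to_blob_eq//|/(_ u)].
by rewrite eqxx.
Qed.

Lemma embeds_contraction : embeds fcon.
Proof.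
split=> X Y; have [u ->] := to_blobP X; have [v ->] := to_blobP Y; rewrite !fconE.
  have -> : adj (to_blob u) (to_blob v) = (to_blob u != to_blob v) &&
    [exists x in blob a b u, [exists y in blob a b v, adj x y]] by [].
  split=> [/andP[/eqP uv /exists_inP[x /blobP ux /exists_inP[y /blobP vy xy]]]|].
    case/(emb_adj ef): xy => l lE; rewrite ux vy lE; have [lk|lk] := eqVneq l k.
      by case: uv; apply/to_blob_eq; rewrite ux vy lE lk proj_flip.
    by exists l; rewrite proj_flip_neq.
  case=> l lE; have lk : l != k.
    apply/eqP => lk; have := flip_at l (proj (f u)); rewrite -lE lk !ffunE eqxx.
    by [].
  apply/andP; split.
    by apply/eqP => /to_blob_eq e; have := flip_neq_self l (proj (f u)); rewrite -lE e eqxx.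
  rewrite -proj_flip_neq // in lE.
  case/esym/proj_eq_flip: lE => e.
    apply/exists_inP; exists u; first exact/blobP.
    by apply/exists_inP; exists v; [exact/blobP|apply: (emb_flip ef (k := l))].
  (* Now [u] and [v] differ exactly in [k] and [l]. The midpoint of a geodesic lies in the blob of
     [u] or in that of [v] and provides the edge between them. *)
  have uv : u != v.
    apply/eqP => uv; have := flip_at l (f u); rewrite {2}uv e uv !flipE eqxx (negbTE lk).
    by case: (f v l).
  have [m [w [uvm wE]]] := emb_step ef uv.
  have : (m == k) || (m == l).
    by move: uvm; rewrite e !flipE; case: (m == k); case: (m == l); case: (f u m).
  case/orP => /eqP mE; rewrite mE in wE.
    apply/exists_inP; exists w; first by apply/blobP; rewrite wE proj_flip.
    apply/exists_inP; exists v; first exact/blobP.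
    by apply: (emb_flip ef (k := l)); rewrite e wE flipC.
  apply/exists_inP; exists u; first exact/blobP.
  apply/exists_inP; exists w; last exact: (emb_flip ef (k := l)).
  by apply/blobP; rewrite e wE proj_flip.
(* A step from a representative that already agrees with [v] in direction [k] survives the
   contraction. If [u] disagrees there and its own step has direction [k], that step leads to such a
   representative. *)
move=> uv; have step x : proj (f x) = proj (f u) -> f x k = f v k ->
    exists l w, proj (f u) l != proj (f v) l /\ fcon w = flip l (proj (f u)).
  move=> xu xvk; have xv : x != v by apply: contraNneq uv => <-; apply/eqP/to_blob_eq.
  have [l [w [xvl wE]]] := emb_step ef xv.
  have lk : l != k by apply: contraNneq xvl => ->; rewrite xvk.
  exists l, (to_blob w); rewrite fconE wE proj_flip_neq // xu; split=> //.
  by rewrite -xu !ffunE lk.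
have [e|e] := eqVneq (f u k) (f v k); first exact: step e.
have uv' : u != v by apply: contraNneq uv => ->.
have [l [w [uvl wE]]] := emb_step ef uv'.
have [lk|lk] := eqVneq l k.
  apply: (step w); rewrite wE lk ?proj_flip // flip_at.
  by move: e; case: (f u k); case: (f v k).
exists l, (to_blob w); rewrite fconE wE proj_flip_neq //; split=> //.
by rewrite !ffunE lk.
Qed.

Lemma card_contraction : #|contraction a b| < #|G|.
Proof.
pose h (X : contraction a b) := odflt a [pick u | X == to_blob u].
have hK : cancel h to_blob.
  move=> X; rewrite /h; case: pickP => [u /eqP//|].
  by have [u ->] := to_blobP X; move/(_ u); rewrite eqxx.
rewrite -(card_codom (can_inj hK)).
have ab : to_blob a = to_blob b by apply/to_blob_eq; rewrite fb proj_flip.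
have aNb : a != b by apply/eqP => e; have := flip_neq_self k (f a);
  rewrite -fb e eqxx.
suff [x xN] : exists x, x \notin codom h.
  rewrite -cardsE -cardsT; apply: proper_card; rewrite properT.
  by apply: contraNneq xN => /setP/(_ x); rewrite !inE.
have [xa|] := boolP (a \in codom h); last by exists a.
exists b; apply/codomP => -[X bE]; case/codomP: xa => Y aE.
case/eqP: aNb; rewrite aE bE; congr h.
by rewrite -(hK X) -(hK Y) -aE -bE ab.
Qed.

Lemma star_center_contraction o :
  star_center fcon (to_blob o) <->
  (forall v l, l != k -> f v l != f o l ->
     exists w, forall m, m != k -> f w m = flip l (f v) m).
Proof.
split=> so v l.
  move=> lk vol; have [|X] := so (to_blob v) l; first by rewrite !fconE !ffunE lk.
  have [w ->] := to_blobP X; rewrite !fconE -proj_flip_neq // => /proj_eq wE.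
  by exists w.
have [{}v ->] := to_blobP v; rewrite !fconE !ffunE.
have [->|lk] := eqVneq l k; first by rewrite eqxx.
move=> /so -/(_ lk) [w wE]; exists (to_blob w); rewrite fconE.
by rewrite -proj_flip_neq //; apply/proj_eq.
Qed.

Lemma daisy_contraction o : star_center f o -> daisy_cube (contraction a b).
Proof.
move=> so; apply: (star_center_daisy embeds_contraction (o := to_blob o)).
by apply/star_center_contraction => v l _ /so[w wE]; exists w; rewrite wE.
Qed.
End Minors.

Lemma card_not_isomorphic (G H : sgraph) : #|H| < #|G| -> ~ isomorphic H G.
Proof. by move=> lt /isomorphic_card e; rewrite e ltnn in lt. Qed.

Lemma not_OD_restriction (I : finType) (G : sgraph) (f : G -> {ffun I -> bool})
    (a b : G) k : embeds f -> f b = flip k (f a) ->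
  ~ daisy_cube (restriction a b) -> ~ in_OD G.
Proof.
move=> ef fb nd [_ _ min]; apply: nd; apply: min.
  by apply: pc_minor_restriction (pc_minor_refl G) _;
    apply: (emb_flip ef (k := k) fb).
exact/card_not_isomorphic/(card_restriction ef fb).
Qed.

Lemma not_OD_contraction (I : finType) (G : sgraph) (f : G -> {ffun I -> bool})
    (a b : G) k : embeds f -> f b = flip k (f a) ->
  ~ daisy_cube (contraction a b) -> ~ in_OD G.
Proof.
move=> ef fb nd [_ _ min]; apply: nd; apply: min.
  by apply: pc_minor_contraction (pc_minor_refl G) _;
    apply: (emb_flip ef (k := k) fb).
exact/card_not_isomorphic/(card_contraction ef fb).
Qed.

(** Daisy cubes are closed under restriction and contraction, so along any sequence of minors only
    the first step has to be checked. *)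
Lemma in_OD_one_step (I : finType) (G : sgraph) (f : G -> {ffun I -> bool}) :
  embeds f -> ~ daisy_cube G ->
  (forall a b k, f b = flip k (f a) ->
     daisy_cube (restriction a b) /\ daisy_cube (contraction a b)) ->
  in_OD G.
Proof.
move=> ef ndG step; split=> //; first exact: embeds_partial_cube ef.
move=> H0 minor nisoH; suff [//|eH] : daisy_cube H0 \/ H0 = G.
  by case: nisoH; rewrite eH; exists id => //; exists id.
elim: {nisoH} minor => [|H a b _ [dH|eH] ab|H a b _ [dH|eH] ab]; first by right.
all: left.
all: try by move: a b ab; rewrite eH => a b /(emb_adj ef)[k /step[]].
all: have [n [g eg]] := partial_cube_embeds (daisy_partial_cube dH).
all: have [k kE] := (emb_adj eg a b).1 ab; have [o so] := daisy_star_center eg dH.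
  exact: (daisy_restriction eg kE so).
exact: (daisy_contraction eg kE so).
Qed.

(** Connectedness and the absence of triangles leave only stars: some vertex is adjacent to all
    others, and it is a centre. *)
Lemma small_partial_cube_daisy (G : sgraph) : 0 < #|G| -> #|G| <= 3 ->
  partial_cube G -> daisy_cube G.
Proof.
move=> /card_gt0P[u _] le3 /partial_cube_embeds[n [f ef]].
have [o oP] : exists o : G, forall v, v != o -> adj o v.
  have [/forallP uP|] := boolP [forall v, (v != u) ==> adj u v].
    by exists u => v; apply/implyP/uP.
  rewrite negb_forall => /existsP[v]; rewrite negb_imply => /andP[vu uv].
  have [k [w [vwk wE]]] := emb_step ef vu.
  have vw : adj v w by apply: (emb_flip ef (k := k) wE).
  have wu : w != u by apply: contraNneq uv => <-; rewrite adj_sym.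
  have wv : w != v by apply: contraTneq vw => ->; rewrite adj_irr.
  (* The vertices are exhausted by [u], [v], [w]; as [u] and [v] are not adjacent, the step from [u]
     towards [v] must go to [w]. *)
  have all x : x \in [:: u; v; w].
    have un : uniq [:: u; v; w] by rewrite /= !inE negb_or eq_sym vu eq_sym wu eq_sym wv.
    have := card_uniqP un; rewrite /= => c3.
    have /eqP/setP/(_ x) : [set x in [:: u; v; w]] == [set: G].
      by rewrite eqEcard subsetT cardsT cardsE c3.
    by rewrite !inE.
  have uv' : u != v by rewrite eq_sym.
  have [l [x [_ xE]]] := emb_step ef uv'.
  have ux : adj u x by apply: (emb_flip ef (k := l) xE).
  have xw : x = w.
    have := all x; rewrite !inE => /or3P[/eqP e|/eqP e|/eqP//].
      by rewrite e adj_irr in ux.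
    by rewrite -e ux in uv.
  exists w => y yw; have := all y; rewrite !inE (negbTE yw) orbF.
  by case/orP => /eqP->; rewrite adj_sym // -xw.
apply: (star_center_daisy ef (o := o)) => v k vok.
have vo : v != o by apply: contraNneq vok => ->.
have [l lE] := (emb_adj ef o v).1 (oP v vo).
exists o; rewrite lE; suff -> : k = l by rewrite flipK.
by apply/eqP; move: vok; rewrite lE flipE; case: (k == l) => //=; rewrite eqxx.
Qed.

(** * Coding the vertices of the product *)

Section Coding.
Variables r s : nat.

(* Two coordinates for each factor P_3, whose vertices 0, 1, 2 are coded 10, 00,
   01, and one for each factor K_2. *)
Definition key : finType := ('I_r * bool + 'I_s)%type.

Definition mid : 'I_3 := Ordinal (isT : 1 < 3).
Definition tip (b : bool) : 'I_3 := if b then ord_max else ord0.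

Definition code (z : B r s) : {ffun key -> bool} :=
  [ffun k : key => match k with
            | inl ib => z.1 ib.1 == tip ib.2
            | inr j => z.2 j
            end].

Definition valid (c : {ffun key -> bool}) : bool :=
  [forall i, ~~ (c (inl (i, true)) && c (inl (i, false)))].

Definition decode (c : {ffun key -> bool}) : B r s :=
  ([ffun i => if c (inl (i, true)) then tip true
              else if c (inl (i, false)) then tip false else mid],
   [ffun j => c (inr j)]).

Lemma I3P (x : 'I_3) : [\/ x = tip false, x = mid | x = tip true].
Proof.
case: x => [[|[|[|//]]] p]; [apply: Or31|apply: Or32|apply: Or33];
  exact/val_inj.
Qed.

Lemma codeE1 z i b : code z (inl (i, b)) = (z.1 i == tip b).
Proof. by rewrite ffunE. Qed.

Lemma codeE2 z j : code z (inr j) = z.2 j.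
Proof. by rewrite ffunE. Qed.

Lemma valid_code z : valid (code z).
Proof.
apply/forallP => i; rewrite !codeE1.
by case: (I3P (z.1 i)) => ->.
Qed.

Lemma codeK : cancel code decode.
Proof.
move=> [z1 z2]; congr pair; apply/ffunP => i; rewrite !ffunE //=.
by case: (I3P (z1 i)) => ->.
Qed.

Lemma code_inj : injective code. Proof. exact: can_inj codeK. Qed.

Lemma decodeK c : valid c -> code (decode c) = c.
Proof.
move=> /forallP vc; apply/ffunP => -[[i b]|j]; last by rewrite codeE2 ffunE.
rewrite codeE1 ffunE; have := vc i.
by case: b; case: (c (inl (i, true))); case: (c (inl (i, false))).
Qed.

Lemma validN c i b : valid c -> c (inl (i, b)) -> c (inl (i, ~~ b)) = false.
Proof.
move=> /forallP/(_ i) vc cib; apply/negP => cib'.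
by case: b cib cib' vc => /= -> ->.
Qed.

Lemma valid_flip_r c j : valid c -> valid (flip (inr j) c).
Proof. by move=> /forallP vc; apply/forallP => i; rewrite !flip_neq. Qed.

Lemma valid_flip_l c i b : valid c ->
  valid (flip (inl (i, b)) c) = c (inl (i, b)) || ~~ c (inl (i, ~~ b)).
Proof.
move=> vc; apply/forallP/idP => [/(_ i)|h i'].
  rewrite !flipE !(inj_eq inl_inj) !xpair_eqE eqxx /=.
  by case: b => /=; case: (c (inl (i, true))); case: (c (inl (i, false))).
have := forallP vc i'; rewrite !flipE !(inj_eq inl_inj) !xpair_eqE.
have [->|_] := eqVneq i' i; last by [].
by move: h; case: b => /=; case: (c (inl (i, true))); case: (c (inl (i, false))).
Qed.

Lemma valid_unflip c k : valid c -> c k -> valid (flip k c).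
Proof.
case: k => [[i b]|j] vc ck; last exact: valid_flip_r.
by rewrite valid_flip_l // ck.
Qed.

Lemma embeds_code : embeds code.
Proof.
split=> u v; last first.
  move=> uv; suff [k vk uvk] : exists2 k,
    valid (flip k (code u)) & code u k != code v k.
    by exists k, (decode (flip k (code u))); rewrite decodeK.
  have : code u != code v by rewrite (inj_eq code_inj).
  case/neq_ffun => k uvk; have [vk|nvk] := boolP (valid (flip k (code u))).
    by exists k.
  case: k uvk nvk => [[i b]|j] uvk; last by rewrite valid_flip_r ?valid_code.
  rewrite valid_flip_l ?valid_code // negb_or negbK => /andP[uib uib'].
  (* Turning one tip on is invalid only while the other is on. Since [v] has the first tip, it lacks
     the other, and turning that one off is a valid step towards [v]. *)
  exists (inl (i, ~~ b)); first by rewrite valid_unflip ?valid_code.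
  rewrite uib' (@validN _ i b) ?valid_code //.
  by move: uvk; rewrite (negbTE uib); case: (code v _).
have adjE : adj u v = ((u.1 == v.1) && (#|[set j | u.2 j != v.2 j]| == 1)) ||
  ([exists i, adj (u.1 i : path3) (v.1 i) && [forall j,
    (j != i) ==> (u.1 j == v.1 j)]]
    && (u.2 == v.2)) by [].
rewrite adjE; split=> [/orP[/andP[/eqP e1 /ham1P[j e2]]|/andP[]]|].
- by exists (inr j); apply/ffunP => -[[i b]|j'];
  rewrite flipE ?codeE1 ?codeE2 /= ?e1 // e2 flipE.
- case/existsP => i /andP[ui /forallP uvi] /eqP e2.
  have e1 i' : i' != i -> u.1 i' = v.1 i' by move=> n; apply/eqP/(implyP (uvi i')).
  have [b bE] : exists b, forall b',
    (v.1 i == tip b') = (b' == b) (+) (u.1 i == tip b').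
    case: (I3P (u.1 i)) (I3P (v.1 i)) ui => -> [] -> //= _.
    + by exists false; case.
    + by exists false; case.
    + by exists true; case.
    + by exists true; case.
  exists (inl (i, b)); apply/ffunP => -[[i' b']|j];
    rewrite flipE ?codeE1 ?codeE2 /= ?e2 //.
  rewrite (inj_eq inl_inj) xpair_eqE.
  by have [->|/e1 ->] := eqVneq i' i; rewrite ?bE.
case=> -[[i b]|j] e.
  have e2 : u.2 = v.2.
    by apply/ffunP => j; rewrite -!codeE2 e flip_neq.
  have e1 i' : i' != i -> u.1 i' = v.1 i'.
    move=> ii; have h b' : (u.1 i' == tip b') = (v.1 i' == tip b').
      by rewrite -!codeE1 e flip_neq // (inj_eq inl_inj) xpair_eqE (negbTE ii).
    move: (h true) (h false).
    by case: (I3P (u.1 i')) (I3P (v.1 i')) => -> [] ->.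
  apply/orP; right; rewrite e2 eqxx andbT; apply/existsP; exists i.
  apply/andP; split; last by apply/forallP => i'; apply/implyP => /e1 ->.
  have h b' : (v.1 i == tip b') = (b' == b) (+) (u.1 i == tip b').
    by rewrite -!codeE1 e flipE (inj_eq inl_inj) xpair_eqE eqxx.
  move: (h true) (h false).
  by case: (I3P (u.1 i)) (I3P (v.1 i)) => -> [] ->; case: b {e h}.
have e1 : u.1 = v.1.
  apply/ffunP => i; have h b : (u.1 i == tip b) = (v.1 i == tip b).
    by rewrite -!codeE1 e flip_neq.
  move: (h true) (h false).
  by case: (I3P (u.1 i)) (I3P (v.1 i)) => -> [] ->.
apply/orP; left; rewrite e1 eqxx; apply/ham1P; exists j.
apply/ffunP => j'; rewrite -codeE2 e !flipE codeE2; congr (_ (+) _).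
Qed.

Lemma card_B : #|B r s| = 3 ^ r * 2 ^ s.
Proof. by rewrite card_prod !card_ffun !card_ord card_bool. Qed.
End Coding.

(** * Isometric deletions *)

Section Pairs.
Variables r s : nat.
Implicit Types x y z u v w : B r s.

(* Deleting x and y leaves an isometric subgraph exactly for two kinds of pairs:
   corners that are not opposite vertices of a 4-cycle in a Q_s-fibre, and a corner
   together with the middle vertex of a P_3-fibre ending at it (a spike). *)
Definition corner z := [forall i, z.1 i != mid].
Definition qdiff x y := [set j | x.2 j != y.2 j].
Definition qtwin m x y := (x.1 == y.1) && (#|qdiff x y| == m).
Definition setmid i y : B r s := ([ffun i' => if i' == i then mid else y.1 i'], y.2).
Definition spike x y := corner y && [exists i, x == setmid i y].
Definition iso_pair x y :=
  [|| [&& corner x, corner y & ~~ qtwin 2 x y], spike x y | spike y x].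

Lemma cornerP z : reflect (forall i, exists b, code z (inl (i, b))) (corner z).
Proof.
apply: (iffP forallP) => h i; have := h i.
  case: (I3P (z.1 i)) => e; rewrite e // => _.
    by exists false; rewrite codeE1 e.
  by exists true; rewrite codeE1 e.
by case=> b; rewrite codeE1 => /eqP->; case: b.
Qed.

Lemma cornerPn z : reflect (exists i, forall b, code z (inl (i,
  b)) = false) (~~ corner z).
Proof.
rewrite negb_forall; apply: (iffP existsP) => -[i h]; exists i.
  by move: h; rewrite negbK => /eqP e b; rewrite codeE1 e; case: b.
have := (h true, h false); rewrite negbK !codeE1.
by case: (I3P (z.1 i)) => -> [].
Qed.

Lemma code_corner z i b : corner z -> code z (inl (i, ~~ b)) = ~~ code z (inl (i, b)).
Proof.
move=> /cornerP/(_ i)[b' zb']; have := validN (valid_code z) zb'.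
by case: b b' zb' => [] [] /= -> ->.
Qed.

Lemma fst_eqE x y : (x.1 == y.1) = [forall i, forall b, code x (inl (i,
  b)) == code y (inl (i, b))].
Proof.
apply/eqP/'forall_'forall_eqP => [e i b|e]; first by rewrite !codeE1 e.
apply/ffunP => i; move: (e i true) (e i false); rewrite !codeE1.
by case: (I3P (x.1 i)) (I3P (y.1 i)) => -> [] ->.
Qed.

Lemma qtwin1P x y : reflect (exists j, code y = flip (inr j) (code x)) (qtwin 1 x y).
Proof.
apply: (iffP andP) => [[/eqP e1 /cards1P[j /setP jE]]|[j e]].
  exists j; apply/ffunP => -[[i b]|j']; rewrite flipE ?codeE1 ?codeE2 ?e1 //.
  by have := jE j'; rewrite !inE (inj_eq inr_inj); case: (x.2 j'); case: (y.2 j');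
    case: (j' == j).
split; first by rewrite fst_eqE; apply/'forall_'forall_eqP => i b; rewrite e flip_neq.
apply/cards1P; exists j; apply/setP => j';
  rewrite !inE -!codeE2 e flipE (inj_eq inr_inj).
by case: (code x _); case: (j' == j).
Qed.

Lemma qtwin2P x y : reflect
  (exists j1 j2, j1 != j2 /\ code y = flip (inr j1) (flip (inr j2) (code x)))
  (qtwin 2 x y).
Proof.
apply: (iffP andP) => [[/eqP e1 /cards2P[j1 [j2 [j12 /setP jE]]]]|[j1 [j2 [j12 e]]]].
  exists j1, j2; split=> //.
  apply/ffunP => -[[i b]|j']; rewrite !flipE ?codeE1 ?codeE2 ?e1 //.
  have := jE j'; rewrite !inE !(inj_eq inr_inj) orbC.
  have [->|_] := eqVneq j' j1; first by rewrite (negbTE j12); case: (x.2 j1);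
    case: (y.2 j1).
  by case: (x.2 j'); case: (y.2 j'); case: (j' == j2).
split; first by rewrite fst_eqE; apply/'forall_'forall_eqP => i b;
  rewrite e !flip_neq.
apply/cards2P; exists j1, j2; split=> //; apply/setP => j'.
rewrite !inE -!codeE2 e !flipE !(inj_eq inr_inj).
have [->|_] := eqVneq j' j1; first by rewrite (negbTE j12); case: (code x _).
by case: (code x _); case: (j' == j2).
Qed.

Lemma code_setmid i b y : code y (inl (i, b)) -> code (setmid i y) = flip (inl (i,
  b)) (code y).
Proof.
move=> yib; have yib' := validN (valid_code y) yib.
apply/ffunP => -[[i' b']|j]; rewrite flipE ?codeE1 ?codeE2 //= ffunE (inj_eq inl_inj) xpair_eqE.
have [->|//] := eqVneq i' i; rewrite /= -codeE1.
by case: b b' yib yib' => [] [] /= e e'; rewrite ?e ?e'.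
Qed.

Lemma spikeP x y : reflect
  (corner y /\ exists i b, code y (inl (i, b)) /\ code x = flip (inl (i, b)) (code y))
  (spike x y).
Proof.
apply: (iffP andP) => [[cy /existsP[i /eqP xE]]|[cy [i [b [yib xE]]]]]; split=> //.
  by have [b yib] := cornerP _ cy i; exists i, b; rewrite xE (code_setmid yib).
by apply/existsP; exists i; apply/eqP/code_inj; rewrite (code_setmid yib).
Qed.

Lemma spike_mid_code x y i b : code y (inl (i, b)) -> code x = flip (inl (i,
  b)) (code y) ->
  forall b', code x (inl (i, b')) = false.
Proof.
move=> yib xE b'; have yib' := validN (valid_code y) yib.
rewrite xE flipE (inj_eq inl_inj) xpair_eqE eqxx.
by case: (b) (b') yib yib' => [] [] /= e e'; rewrite ?e ?e'.
Qed.

Lemma spike_mid x y : spike x y -> ~~ corner x.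
Proof.
case/spikeP => _ [i [b [yib xE]]]; apply/cornerPn; exists i => b'.
exact: spike_mid_code yib xE b'.
Qed.

Lemma qtwinC m x y : qtwin m x y = qtwin m y x.
Proof.
rewrite /qtwin eq_sym; congr (_ && (#|pred_of_set _| == _)).
by apply/setP => j; rewrite !inE eq_sym.
Qed.

Lemma iso_pairC x y : iso_pair x y = iso_pair y x.
Proof. by rewrite /iso_pair andbCA qtwinC [X in _ || X]orbC. Qed.

Notation dcode x y := (fun u : delete [set x; y] => code (val u)).

Lemma inD x y z : (z \in ~: [set x; y]) = (code z != code x) && (code z != code y).
Proof. by rewrite !inE negb_or !(inj_eq (@code_inj _ _)). Qed.

Lemma in_delete x y c : valid c -> c != code x -> c != code y ->
  exists z : delete [set x; y], code (val z) = c.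
Proof.
move=> vc cx cy; have zD : decode c \in ~: [set x; y] by rewrite inD decodeK // cx.
by exists (Sub (decode c) zD); rewrite SubK decodeK.
Qed.

Lemma out_delete x y (z : delete [set x; y]) :
  [/\ valid (code (val z)), code (val z) != code x & code (val z) != code y].
Proof. by have := valP z; rewrite inD valid_code => /andP[]. Qed.

(** If [x] is the middle of a [P_3]-fibre, it is the only common neighbour of the two ends, so one
    end must be [y]. Were [y] a middle in some direction too, [x] would be an end of that fibre,
    contradicting that the two vertices differ only in the first one. *)
Lemma embeds_delete_spike x y : embeds (dcode x y) -> ~~ corner x -> spike x y.
Proof.
move=> ed; have edge x' y' i : embeds (dcode x' y') ->
    (forall b, code x' (inl (i, b)) = false) ->
    exists b, code y' = flip (inl (i, b)) (code x').
  move=> e xi.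
  have [->|n0] := eqVneq (code y') (flip (inl (i, false)) (code x'));
    first by exists false.
  have [->|n1] := eqVneq (code y') (flip (inl (i, true)) (code x'));
    first by exists true.
  have nbr b : exists z : delete [set x';
    y'], code (val z) = flip (inl (i, b)) (code x').
    apply: in_delete; last by rewrite eq_sym; case: b.
      by rewrite valid_flip_l ?valid_code // !xi.
    exact: flip_neq_self.
  have [u uE] := nbr false; have [v vE] := nbr true.
  have uv : u != v by apply/eqP => uv; move: uE; rewrite uv vE => /flip_key.
  have [k [w [uvk wE]]] := emb_step e uv.
  have [vw wx _] := out_delete w.
  case/negP: wx; rewrite wE uE; have : (k == inl (i, false)) || (k == inl (i, true)).
    by move: uvk; rewrite uE vE !flipE; case: (k == _); case: (k == _); case: (code x' k).
  case/orP => /eqP kE; first by rewrite kE flipK.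
  have /forallP/(_ i) := vw; rewrite wE uE kE !flipE !(inj_eq inl_inj) !xpair_eqE eqxx /=.
  by rewrite !xi.
case/cornerPn => i xi; have [b yE] := edge _ _ _ ed xi.
have yib : code y (inl (i, b)) by rewrite yE flip_at xi.
apply/spikeP; split; last by exists i, b; split=> //; rewrite yE flipK.
apply: contraT => /cornerPn[i' yi'].
have eyx : embeds (dcode y x) by rewrite setUC.
have [b' xE] := edge y x i' eyx yi'.
have ii : i' != i by apply/eqP => e; rewrite -e yi' in yib.
have xib' : code x (inl (i', b')) by rewrite xE flip_at yi'.
have := yi' b'; rewrite yE flip_neq ?xib' //.
by rewrite (inj_eq inl_inj) xpair_eqE (negbTE ii).
Qed.

Lemma flip2_neq (I : finType) (k l m : I) (c : {ffun I -> bool}) :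
  k != l -> flip m c != flip k (flip l c).
Proof.
move=> kl; apply/eqP => e.
have km : m = k.
  have := congr1 (fun c : {ffun I -> bool} => c k) e.
  rewrite !flipE eqxx (negbTE kl) [k == m]eq_sym.
  by case: eqP => //; case: (c k).
rewrite km in e; have := flip_neq_self l (flip k c).
by rewrite flipC -e eqxx.
Qed.

(** If the first step from [u] hits the deleted vertex [x], it is exchanged with the second one, of
    direction [l]: the vertex reached by flipping [l] first replaces [x]. This fails only if that
    vertex is [y] or if flipping [l] at [u] is invalid. *)
Lemma iso_pair_step x y u v : iso_pair x y ->
  u \in ~: [set x; y] -> v \in ~: [set x; y] -> u != v ->
  exists k w, [/\ w \in ~: [set x;
    y], code u k != code v k & code w = flip k (code u)].
Proof.
rewrite !inD => isoxy /andP[ux uy] /andP[vx vy] uv.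
have [k [w [uvk wE]]] := emb_step (embeds_code r s) uv.
have [wD|] := boolP (w \in ~: [set x; y]).
  by exists k, w.
rewrite inE negbK !inE => wxy.
wlog {wxy} wx : x y isoxy ux uy vx vy / w = x.
  move=> IH; case/orP: wxy => /eqP wE'; first exact: IH.
  by rewrite setUC; apply: IH; rewrite // iso_pairC.
rewrite {w}wx in wE.
have xv : x != v by rewrite -(inj_eq (@code_inj _ _)) eq_sym.
have [l [w [xvl wE']]] := emb_step (embeds_code r s) xv.
have lk : l != k.
  by apply: contraNneq xvl => ->; rewrite wE flip_at; move: uvk; case: (code u k);
    case: (code v k).
have uvl : code u l != code v l by move: xvl; rewrite wE flip_neq.
have vux : valid (flip l (code x)) by rewrite -wE' valid_code.
have xl : code x l = code u l by rewrite wE flip_neq.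
have in_step m : code u m != code v m -> valid (flip m (code u)) ->
    flip m (code u) != code x -> flip m (code u) != code y ->
    exists k w, [/\ w \in ~: [set x; y], code u k != code v k & code w = flip k (code u)].
  by move=> uvm vum nx ny; exists m, (decode (flip m (code u)));
    rewrite inD decodeK // nx.
have flu_x : flip l (code u) != code x.
  by rewrite wE; apply: contraNneq lk => /flip_key->.
have [vul|] := boolP (valid (flip l (code u))).
  have [yE|] := eqVneq (flip l (code u)) (code y); last exact: in_step.
  (* If [k1] were a [P_3] direction, [u] would be the middle of that fibre with the corners [x1] and
     [y1] as its ends, and [v] cannot lie towards both. So both directions belong to [Q_s], which
     makes [x] and [y] opposite in a 4-cycle. *)
  have key_r k1 l1 x1 y1 : k1 != l1 ->
      code x1 = flip k1 (code u) -> code y1 = flip l1 (code u) ->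
      code u k1 != code v k1 -> code u l1 != code v l1 ->
      corner x1 -> corner y1 -> exists j, k1 = inr j.
    case: k1 => [[i b]|j]; last by exists j.
    move=> kl x1E y1E uk ul cx cy; exfalso.
    have bN : (i, ~~ b) != (i, b) by rewrite xpair_eqE eqxx; case: (b).
    have uib : code u (inl (i, ~~ b)) = false /\ code u (inl (i, b)) = false.
      have := code_corner i b cx; rewrite x1E flip_at flip_neq ?(inj_eq inl_inj) //.
      have := valid_code u => /forallP/(_ i).
      by case: (b) => /=; case: (code u _); case: (code u _).
    have [b1] := cornerP _ cy i; rewrite y1E flipE.
    have -> : code u (inl (i, b1)) = false by case: uib; case: (b) (b1) => [] [].
    rewrite addbF => /eqP lE; have bE : b1 = ~~ b.
      move: kl; rewrite -lE (inj_eq inl_inj) xpair_eqE eqxx.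
      by case: (b) (b1) => [] [].
    have vib : code v (inl (i, b)) by move: uk; rewrite uib.2; case: (code v _).
    have := validN (valid_code v) vib.
    by move: ul; rewrite -lE bE uib.1; case: (code v _).
  have kl : k != l by rewrite eq_sym.
  case/or3P: isoxy => [/and3P[cx cy]|/spikeP[_ [i [b [_ e]]]]|/spikeP[_ [i [b [_ e]]]]].
  - have [j1 kE] := key_r k l x y kl wE (esym yE) uvk uvl cx cy.
    have [j2 lE] := key_r l k y x lk (esym yE) wE uvl uvk cy cx.
    case/qtwin2P; exists j2, j1; rewrite -yE wE kE lE flipK; split=> //.
    by apply: contraNneq lk => e; rewrite kE lE e.
  - by have := flip2_neq (inl (i, b)) (code y) kl; rewrite -e wE -yE flipK eqxx.
  - have := flip2_neq (inl (i, b)) (code x) lk; rewrite -e -yE wE flipK eqxx.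
    by [].
(* The flip may be invalid only if [k] and [l] belong to one [P_3]-fibre. Then [x] is its middle,
   and the pair can only be a spike whose corner [y] is the end opposite to [u]. *)
case: l lk wE' xvl uvl vux xl flu_x => [[i b]|j] lk wE' xvl uvl vux xl flu_x;
  last first.
  by rewrite valid_flip_r ?valid_code.
rewrite valid_flip_l ?valid_code // negb_or negbK => /andP[uib uib'].
have xib : code x (inl (i, b)) = false by rewrite xl (negbTE uib).
have xib' : code x (inl (i, ~~ b)) = false.
  by apply/negbTE; move: vux; rewrite valid_flip_l ?valid_code // xib.
have kE : k = inl (i, ~~ b).
  by move: xib'; rewrite wE flipE uib' addbT => /negbFE/eqP.
have nx : ~~ corner x.
  by apply/cornerPn; exists i => b';
    case: b b' xib xib' {kE lk wE' xvl uvl vux xl flu_x uib uib'} => [] [].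
have : spike x y.
  by case/or3P: isoxy => [/and3P[cx]|//|/andP[cx]]; rewrite cx in nx.
case/spikeP => cy [i2 [m [yim xE]]].
have yE : code y = flip (inl (i2, m)) (code x) by rewrite xE flipK.
have {i2 m yim xE} yE : code y = flip (inl (i, b)) (code x).
  have [b2] := cornerP _ cy i; rewrite yE flipE.
  have -> : code x (inl (i, b2)) = false by case: (b) (b2) xib xib' => [] [].
  rewrite addbF => /eqP e; rewrite -e; congr (flip (inl (i, _)) _).
  apply/eqP; case: (eqVneq b2 b) => // b2b.
  case/negP: uy; rewrite yE -e; have -> : b2 = ~~ b by case: (b) (b2) b2b => [] [].
  by rewrite -kE wE flipK.
have vl : code v (inl (i, b)) by move: uvl; rewrite (negbTE uib); case: (code v _).
have vk : code v k = false by rewrite kE (validN (valid_code v) vl).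
(* As [u] and [y] differ only in this fibre, a step of [y] towards [v] in another factor can be
   copied at [u]. *)
have yv : y != v by rewrite -(inj_eq (@code_inj _ _)) eq_sym.
have [k3 [w3 [yvk3 wE3]]] := emb_step (embeds_code r s) yv.
have k3l : k3 != inl (i, b).
  by apply: contraNneq yvk3 => ->; rewrite yE flip_at xib vl.
have k3k : k3 != k.
  by apply: contraNneq yvk3 => ->; rewrite yE flip_neq 1?eq_sym // vk kE xib'.
have uk3 : code u k3 = code y k3 by rewrite yE wE !flip_neq.
apply: (in_step k3); first by rewrite uk3.
- have := valid_code w3; rewrite wE3;
  case: k3 k3l k3k uk3 {yvk3 wE3} => [[i3 b3]|j3] k3l k3k uk3; last first.
    by rewrite !valid_flip_r ?valid_code.
  rewrite !valid_flip_l ?valid_code // -uk3 => /orP[->//|].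
  have i3i : i3 != i.
    apply/eqP => e; move: k3l k3k; rewrite kE e !(inj_eq inl_inj) !xpair_eqE eqxx.
    by case: (b) (b3) => [] [].
  rewrite yE wE !flip_neq => [->||];
    rewrite ?orbT ?kE // (inj_eq inl_inj) xpair_eqE (negbTE i3i) //.
- by rewrite wE; apply: contraNneq k3k => /flip_key->.
- by rewrite yE wE; apply: flip2_neq.
Qed.

Lemma isometric_delete x y : isometric (delete [set x; y]) <-> iso_pair x y.
Proof.
rewrite (isometric_induced (embeds_code r s)); split=> [ed|isoxy]; last first.
  by refine (embeds_induced (embeds_code r s) _) => u v; apply: iso_pair_step.
have eyx : embeds (dcode y x) by rewrite setUC.
rewrite /iso_pair; have [cx|/(embeds_delete_spike ed)->] := boolP (corner x);
  last by rewrite !orbT.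
have [cy|/(embeds_delete_spike eyx)->] := boolP (corner y); last by rewrite !orbT.
apply/orP; left; apply/negP => /qtwin2P[j1 [j2 [j12 yE]]].
have kl : inr j1 != inr j2 :> key r s by rewrite (inj_eq inr_inj).
have nbr j : (j == j1) || (j == j2) -> exists u : delete [set x;
  y], code (val u) = flip (inr j) (code x).
  move=> jj; apply: in_delete; first by rewrite valid_flip_r ?valid_code.
    exact: flip_neq_self.
  by rewrite yE flip2_neq.
have [|u uE] := nbr j1; first by rewrite eqxx.
have [|v vE] := nbr j2; first by rewrite eqxx orbT.
have uv : u != v.
  by apply: contraNneq kl => uv; move: uE; rewrite uv vE => /flip_key->.
have [k [w [uvk wE]]] := emb_step ed uv.
have [_ wx wy] := out_delete w.
move: uvk wx wy; rewrite wE uE vE yE !flipE.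
have [->|_] := eqVneq k (inr j1); first by rewrite flipK eqxx.
have [->|_] := eqVneq k (inr j2); first by rewrite flipC eqxx.
by rewrite eqxx.
Qed.
End Pairs.

Notation dcode x y := (fun u : delete [set x; y] => code (val u)).

(** * Daisy deletions *)

Section PairsDaisy.
Variables r s : nat.
Implicit Types x y z u v w : B r s.

Definition daisy_pair x y :=
  [&& corner x, corner y & (x.2 == y.2) || qtwin 1 x y].
Definition antipodal x y := [forall k, code x k != code y k].

Lemma embeds_delete x y : iso_pair x y -> embeds (dcode x y).
Proof. by move/isometric_delete/(isometric_induced (embeds_code r s)). Qed.

Lemma daisy_pair_iso x y : daisy_pair x y -> iso_pair x y.
Proof.
case/and3P=> cx cy h; rewrite /iso_pair cx cy /=; apply/orP; left.
rewrite /qtwin; apply/negP => /andP[_ /eqP q2]; case/orP: h => [/eqP e|/andP[_ /eqP]].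
  by move: q2; rewrite (_ : qdiff x y = set0) ?cards0 //; apply/setP => j;
    rewrite !inE e eqxx.
by rewrite q2.
Qed.

Lemma corner_flip z i b : corner z -> valid (flip (inl (i, b)) (code z)) ->
  code z (inl (i, b)).
Proof.
move=> cz; rewrite valid_flip_l ?valid_code // (code_corner i b cz) negbK.
by rewrite orbb.
Qed.

Lemma qneq x y : reflect (exists j, code x (inr j) != code y (inr j)) (x.2 != y.2).
Proof.
apply: (iffP idP) => [/neq_ffun[j]|[j]]; first by exists j; rewrite !codeE2.
by apply: contraNneq => e; rewrite !codeE2 e.
Qed.

Lemma daisy_pair_daisy x y : 1 < r + s -> x != y -> daisy_pair x y ->
  daisy_cube (delete [set x; y]).
Proof.
move=> rs xy dxy; have ed := embeds_delete (daisy_pair_iso dxy).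
have /and3P[cx cy h] := dxy.
pose c : {ffun key r s -> bool} :=
  [ffun k => if k is inr j then ~~ code x (inr j) else false].
have cl i b : c (inl (i, b)) = false by rewrite ffunE.
have cr j : c (inr j) = ~~ code x (inr j) by rewrite ffunE.
have vc : valid c by apply/forallP => i; rewrite !cl.
have c_corner (i : 'I_r) z : corner z -> c != code z.
  by move=> /cornerP/(_ i)[b zb]; apply: contraTneq zb => <-; rewrite cl.
have [o oE] : exists o : delete [set x; y], code (val o) = c.
  (* A corner has a tip where [c] has none, so only [r = 0] needs care: there [y] differs from [x]
     in one coordinate, and a second coordinate separates it from [c]. *)
  have [r0|r0] := posnP r; last by apply: in_delete;
    rewrite // (c_corner (Ordinal r0)).
  have s2 : 1 < s by rewrite r0 in rs.
  have cN z j : code z (inr j) = code x (inr j) -> c != code z.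
    by move=> e; apply/eqP => /ffunP/(_ (inr j)); rewrite cr e; case: (code x _).
  apply: in_delete; rewrite ?(cN x (Ordinal (ltnW s2))) //.
  have nq : x.2 != y.2.
    apply: contra_neq xy => e2; apply: code_inj; apply/ffunP => -[[i b]|j].
      by have := ltn_ord i; rewrite {2}r0.
    by rewrite !codeE2 e2.
  rewrite (negbTE nq) in h; have /qtwin1P[j yE] := h.
  have [j' jj] : exists j', j' != j.
    have [e|] := eqVneq j (Ordinal s2); last by move=> e; exists (Ordinal s2); rewrite eq_sym.
    by exists (Ordinal (ltnW s2)); rewrite e.
  by apply: (cN y j'); rewrite yE flip_neq // (inj_eq inr_inj).
apply: (star_center_daisy ed (o := o)) => v k; rewrite oE => vko.
have [vv vx vy] := out_delete v.
have vf : valid (flip k (code (val v))).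
  case: k vko => [[i b]|j] vko; last by rewrite valid_flip_r.
  by apply: valid_unflip => //; move: vko; rewrite cl; case: (code _ _).
have flip_back z : flip k (code (val v)) = code z -> code (val v) = flip k (code z).
  by move=> <-; rewrite flipK.
have tipN z (i : 'I_r) b : corner z -> k = inl (i,
  b) -> flip k (code (val v)) = code z -> False.
  move=> cz kE e; have vE := flip_back _ e; rewrite kE in vE.
  have := corner_flip (i := i) (b := b) cz; rewrite -vE vv => /(_ isT) zk.
  by move: vko; rewrite vE kE flip_at zk cl.
apply: in_delete => //.
  apply/eqP => e; case: k vko vf flip_back tipN e =>
    [[i b]|j] vko vf flip_back tipN e.
    exact: (tipN x i b).
  by move: vko; rewrite (flip_back _ e) flip_at cr eqxx.
apply/eqP => e; case: k vko vf flip_back tipN e => [[i b]|j] vko vf flip_back tipN e.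
  exact: (tipN y i b).
(* If a flip towards [o] lands on [y], then [y] disagrees with [x] in that coordinate. The two are
   then neighbours along it, and the flip would start at the deleted [x]. *)
have yk : code y (inr j) = ~~ code x (inr j).
  by move: vko; rewrite (flip_back _ e) flip_at cr; case: (code x _);
    case: (code y _).
have nq : x.2 != y.2 by apply/qneq; exists j; rewrite yk; case: (code x _).
rewrite (negbTE nq) in h; have /qtwin1P[j' yE] := h.
have jj : j = j'.
  apply/eqP; move: yk; rewrite yE flipE (inj_eq inr_inj).
  by case: (j == j') => //=; case: (code x _).
by case/eqP: vx; rewrite (flip_back _ e) yE jj flipK.
Qed.

(** The centre agrees at [j] with [x] or [y], and the [j]-neighbour of that vertex would have to
    flip onto it. The graph [H] is left open so that restrictions are covered as well. *)
Lemma no_star_q (H : sgraph) (g : H -> {ffun key r s -> bool}) x y j o :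
  (forall z : H, g z != code x) -> (forall z : H, g z != code y) ->
  (exists u : H, g u = flip (inr j) (code x)) -> (exists u : H,
    g u = flip (inr j) (code y)) ->
  code x (inr j) != code y (inr j) -> ~ star_center g o.
Proof.
move=> gx gy [u uE] [v vE] xyj so.
have [e|e] := eqVneq (g o (inr j)) (code x (inr j)).
  have [|w wE] := so u (inr j); first by rewrite uE flip_at e; case: (code x _).
  by have := gx w; rewrite wE uE flipK eqxx.
have [|w wE] := so v (inr j).
  by rewrite vE flip_at; move: e xyj; case: (code x _); case: (code y _);
    case: (g o _).
by have := gy w; rewrite wE vE flipK eqxx.
Qed.

(** If the centre is not at the tip [~~ b], the vertex at that tip of the fibre of [x] would have to
    move to [x]. If it is, a vertex at the tip [b] would have to turn on the opposite tip too, which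
    is invalid. *)
Lemma no_star_spike (H : sgraph) (g : H -> {ffun key r s -> bool}) x i b o :
  (forall z : H, valid (g z)) -> (forall z : H, g z != code x) ->
  (forall b, code x (inl (i, b)) = false) ->
  (exists u : H, g u = flip (inl (i, ~~ b)) (code x)) ->
  (exists v : H, g v (inl (i, b))) -> ~ star_center g o.
Proof.
move=> gv gx xi [u uE] [v vib] so; have vib' := validN (gv v) vib.
have [ob|/negbTE ob] := boolP (g o (inl (i, ~~ b))); last first.
  have [|w wE] := so u (inl (i, ~~ b)); first by rewrite uE flip_at xi ob.
  by have := gx w; rewrite wE uE flipK eqxx.
have [|w wE] := so v (inl (i, ~~ b)); first by rewrite vib' ob.
have := gv w; rewrite wE valid_flip_l // vib' negbK vib.
by [].
Qed.

Lemma free_key y i : corner y -> 1 < r + s ->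
  exists2 k, forall b, k != inl (i, b) & valid (flip k (code y)).
Proof.
move=> cy rs; have [s0|s0] := posnP s; last first.
  by exists (inr (Ordinal s0)) => //; rewrite valid_flip_r ?valid_code.
have r2 : 1 < r by rewrite s0 addn0 in rs.
have [i' ii] : exists i', i' != i.
  have [e|] := eqVneq i (Ordinal r2); last by move=> e; exists (Ordinal r2);
    rewrite eq_sym.
  by exists (Ordinal (ltnW r2)); rewrite e.
have [b yib] := cornerP _ cy i'; exists (inl (i', b)).
  by move=> b'; rewrite (inj_eq inl_inj) xpair_eqE (negbTE ii).
by rewrite valid_unflip ?valid_code.
Qed.

(** Direction [k] is to be restricted away while [k'] leads to a neighbour of [y] that survives. The
    two may belong to one [P_3], leaving its tip and passing on to the other. For [(1, 1)] the only
    factor besides [i] is a [K_2], with a single direction. *)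
Lemma free_keys y i : corner y -> 1 < r + s -> (r, s) != (1, 1) ->
  exists k k', [/\ forall b, k != inl (i, b), forall b, k' != inl (i, b), k != k',
    valid (flip k' (code y)) & valid (flip k (flip k' (code y)))].
Proof.
move=> cy rs rs11; have [r2|r1] := leqP 2 r.
  have [i' ii] : exists i', i' != i.
    have [e|] := eqVneq i (Ordinal r2); last by move=> e; exists (Ordinal r2); rewrite eq_sym.
    by exists (Ordinal (ltnW r2)); rewrite e.
  have [b yib] := cornerP _ cy i'; have yib' := validN (valid_code y) yib.
  have vy : valid (flip (inl (i', b)) (code y)) by rewrite valid_unflip ?valid_code.
  have bN : inl (i', ~~ b) != inl (i',
    b) :> key r s by rewrite (inj_eq inl_inj) xpair_eqE eqxx; case: (b).
  exists (inl (i', ~~ b)), (inl (i', b)); split=> //.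
  - by move=> b'; rewrite (inj_eq inl_inj) xpair_eqE (negbTE ii).
  - by move=> b'; rewrite (inj_eq inl_inj) xpair_eqE (negbTE ii).
  - by rewrite valid_flip_l // negbK flip_at yib orbT.
have r0 : 0 < r by apply: leq_ltn_trans (ltn_ord i).
have s2 : 1 < s by move: rs11; rewrite xpair_eqE; lia.
pose j0 := Ordinal s2; pose j1 := Ordinal (ltnW s2).
by exists (inr j0), (inr j1); rewrite !valid_flip_r ?valid_code.
Qed.

Lemma daisy_delete x y : 1 < r + s -> x != y -> iso_pair x y ->
  daisy_cube (delete [set x; y]) -> daisy_pair x y.
Proof.
move=> rs xy isoxy; have ed := embeds_delete isoxy.
move=> /(daisy_star_center ed)[o so].
have spikeN x1 y1 (o1 : delete [set x1;
  y1]) : spike x1 y1 -> ~ star_center (dcode x1 y1) o1.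
  move=> /spikeP[cy [i [b [yib xE]]]].
  have yE : code y1 = flip (inl (i, b)) (code x1) by rewrite xE flipK.
  have xi := spike_mid_code yib xE.
  apply: (@no_star_spike _ _ x1 i b).
  - by move=> z; case: (out_delete z).
  - by move=> z; case: (out_delete z).
  - exact: xi.
  - apply: in_delete; [by rewrite valid_flip_l ?valid_code // !xi|exact: flip_neq_self|].
    by rewrite yE; apply/eqP => /flip_key[]; case: (b).
  have [k ki vk] := free_key i cy rs.
  have [|||v vE] := @in_delete _ _ x1 y1 (flip k (code y1)); first by [].
  - by rewrite xE; apply: contraNneq (ki b) => /flip_key->.
  - exact: flip_neq_self.
  by exists v; rewrite vE flip_neq // eq_sym ki.
case/or3P: (isoxy) => [/and3P[cx cy _]|/spikeN/(_ so)//|spk]; last first.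
  by move: ed o so; rewrite setUC => ed o so; case: (spikeN _ _ o spk so).
rewrite /daisy_pair cx cy /=; apply: contraT;
  rewrite negb_or => /andP[/qneq[j xyj] nq].
have nyE : flip (inr j) (code x) != code y by apply: contra nq => /eqP e;
  apply/qtwin1P; exists j.
case: (@no_star_q _ (dcode x y) x y j o) => //.
- by move=> z; case: (out_delete z).
- by move=> z; case: (out_delete z).
- by apply: in_delete => //; [rewrite valid_flip_r ?valid_code|apply: flip_neq_self].
- apply: in_delete => //; [by rewrite valid_flip_r ?valid_code| |apply: flip_neq_self].
  by apply: contraNneq nyE => <-; rewrite flipK.
Qed.
End PairsDaisy.

(** * Minimal non-daisy deletions *)

Section PairsMinimal.
Variables r s : nat.
Implicit Types x y z u v w : B r s.

Lemma restriction_delete x y (a b : delete [set x; y]) k c :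
  iso_pair x y -> code (val b) = flip k (code (val a)) ->
  valid c -> c != code x -> c != code y -> c k = code (val a) k ->
  exists u : restriction a b, code (val (val u)) = c.
Proof.
move=> isoxy bE vc cx cy ck; have ed := embeds_delete isoxy.
have [z zE] := in_delete vc cx cy.
have zH : z \in halfspace a b by apply/(halfspaceP ed bE); rewrite zE.
by exists (Sub z zH).
Qed.

(** The halfspace of direction [k] that contains [a] keeps both witnesses of [no_star_spike]: the
    end of the fibre of [x] opposite to [y], and the neighbour [a] of [y]. *)
Lemma spike_not_OD x y : spike x y -> 1 < r + s -> (r, s) != (1, 1) ->
  ~ in_OD (delete [set x; y]).
Proof.
move=> spk rs rs11; have isoxy : iso_pair x y by rewrite /iso_pair spk orbT.
have [cy [i [b [yib xE]]]] := spikeP _ _ spk.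
have xi := spike_mid_code yib xE.
have [k [k' [ki k'i kk' vk' vkk']]] := free_keys i cy rs rs11.
have yE : code y = flip (inl (i, b)) (code x) by rewrite xE flipK.
have [a aE] : exists a : delete [set x; y], code (val a) = flip k' (code y).
  apply: in_delete => //; last exact: flip_neq_self.
  by rewrite xE; apply: contraNneq (k'i b) => /flip_key->.
have [a' a'E] : exists a : delete [set x;
  y], code (val a) = flip k (flip k' (code y)).
  apply: in_delete => //; first by rewrite xE eq_sym flip2_neq.
  apply/eqP => /(congr1 (flip k')); rewrite flipC flipK => /flip_key e.
  by rewrite e eqxx in kk'.
have ed := embeds_delete isoxy.
have a'aE : code (val a') = flip k (code (val a)) by rewrite a'E aE.
apply: (not_OD_restriction ed a'aE) =>
  /(daisy_star_center (embeds_restriction ed a'aE))[o].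
apply: (@no_star_spike _ _ _ _ x i b).
- by move=> z; case: (out_delete (val z)).
- by move=> z; case: (out_delete (val z)).
- exact: xi.
- apply: (restriction_delete (k := k)) => //.
  + by rewrite valid_flip_l ?valid_code // !xi.
  + exact: flip_neq_self.
  + by rewrite yE; apply/eqP => /flip_key[]; case: (b).
  by rewrite aE !flip_neq // xE flip_neq.
have aH : a \in halfspace a a' by apply/(halfspaceP ed a'aE).
by exists (Sub a aH); rewrite /= aE flip_neq // eq_sym k'i.
Qed.

Lemma corners_not_OD x y : corner x -> corner y -> iso_pair x y ->
  ~~ daisy_pair x y -> ~~ antipodal x y -> ~ in_OD (delete [set x; y]).
Proof.
move=> cx cy isoxy; rewrite /daisy_pair cx cy /= negb_or => /andP[/qneq[j xyj] nq].
rewrite negb_forall => /existsP[k0]; rewrite negbK => /eqP xyk0.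
(* In a [P_3] factor where the corners agree, the common tip is chosen, so that the flip turns it
   off and stays valid. *)
have [k xyk kP] : exists2 k, code x k = code y k &
    code x k \/ exists j, k = inr j.
  case: k0 xyk0 => [[i b]|j0] e; last by exists (inr j0) => //; right; exists j0.
  have [xib|/negbTE xib] := boolP (code x (inl (i, b)));
    first by exists (inl (i, b)) => //; left.
  exists (inl (i, ~~ b)); first by rewrite !code_corner // e.
  by left; rewrite code_corner // xib.
have kj : k != inr j by apply: contraNneq xyj => <-; rewrite xyk.
have nyE : flip (inr j) (code x) != code y by apply: contra nq => /eqP e;
  apply/qtwin1P; exists j.
have vx : valid (flip (inr j) (code x)) by rewrite valid_flip_r ?valid_code.
have [a aE] : exists a : delete [set x; y], code (val a) = flip (inr j) (code x).
  by apply: in_delete => //; apply: flip_neq_self.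
have [a' a'E] : exists a : delete [set x;
  y], code (val a) = flip k (flip (inr j) (code x)).
  apply: in_delete.
  - case: kP => [xk|[j' ->]]; last by rewrite valid_flip_r.
    by rewrite valid_unflip // flip_neq.
  - apply/eqP => /(congr1 (fun c : {ffun key r s -> bool} => c k));
    rewrite flip_at flip_neq //.
    by case: (code x k).
  - apply/eqP => /(congr1 (fun c : {ffun key r s -> bool} => c k));
    rewrite flip_at flip_neq // xyk.
    by case: (code y k).
have ed := embeds_delete isoxy.
have a'aE : code (val a') = flip k (code (val a)) by rewrite a'E aE.
apply: (not_OD_restriction ed a'aE) =>
  /(daisy_star_center (embeds_restriction ed a'aE))[o].
apply: (@no_star_q _ _ _ _ x y j) => //.
- by move=> z; case: (out_delete (val z)).
- by move=> z; case: (out_delete (val z)).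
- apply: (restriction_delete (k := k)) => //; first exact: flip_neq_self.
  by rewrite aE.
apply: (restriction_delete (k := k)) => //.
- by rewrite valid_flip_r ?valid_code.
- by apply: contraNneq nyE => <-; rewrite flipK.
- exact: flip_neq_self.
by rewrite aE !flip_neq.
Qed.

(** Opposite to a middle vertex, [y] would have to occupy both tips at once. *)
Lemma antipodal_corner x y : antipodal x y -> corner x.
Proof.
move=> /forallP xy; apply/cornerP => i.
have := (xy (inl (i, true)), xy (inl (i, false)));
  have /forallP/(_ i) := valid_code y.
case e1: (code x (inl (i, true))); first by exists true.
case e2: (code x (inl (i, false))); first by exists false.
by case: (code y _); case: (code y _) => // _ [].
Qed.

Lemma antipodalC x y : antipodal x y = antipodal y x.
Proof. by apply: eq_forallb => k; rewrite eq_sym. Qed.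

Section Antipodal.
Hypotheses (s1 : 0 < s) (rs3 : 2 < 2 * r + s).

(** Given [0 < s], the condition [2 < 2 * r + s] excludes just [Q_1] and [Q_2]; an antipodal pair of
    [Q_2] is opposite in a 4-cycle. *)
Lemma antipodal_iso x y : antipodal x y -> iso_pair x y.
Proof.
move=> axy; have cx := antipodal_corner axy.
have cy : corner y by apply: (@antipodal_corner y x); rewrite antipodalC.
rewrite /iso_pair cx cy /=; apply/orP; left; apply/negP => /qtwin2P[j1 [j2 [j12 yE]]].
have k12 (k : key r s) : k = inr j1 \/ k = inr j2.
  have := forallP axy k; rewrite yE !flipE.
  have [->|_] := eqVneq k (inr j1); first by left.
  have [->|_] := eqVneq k (inr j2); first by right.
  by rewrite eqxx.
have r0 : r = 0.
  by have [//|rp] := posnP r; have := k12 (inl (Ordinal rp, true)); case.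
have : #|[set: 'I_s]| <= #|[set j1; j2]|.
  by apply/subset_leq_card/subsetP => j _; rewrite !inE;
    case: (k12 (inr j)) => -[->]; rewrite eqxx ?orbT.
by rewrite cardsT card_ord cards2 j12; move: rs3; rewrite r0; lia.
Qed.

Lemma antipodal_not_daisy x y : antipodal x y -> ~~ daisy_pair x y.
Proof.
move=> axy; rewrite /daisy_pair !negb_and negb_or; apply/orP; right; apply/orP; right.
apply/andP; split.
  by apply/qneq; exists (Ordinal s1); apply: (forallP axy).
apply/negP => /qtwin1P[j yE].
have kj (k : key r s) : k = inr j.
  by apply/eqP; have := forallP axy k; rewrite yE flipE; case: (k == _) => //;
    rewrite eqxx.
have r0 : r = 0.
  by have [//|rp] := posnP r; have := kj (inl (Ordinal rp, true)).
have s2 : 1 < s by lia.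
by have := etrans (kj (inr (Ordinal s1))) (esym (kj (inr (Ordinal s2)))).
Qed.

Lemma antipodal_neq x y : antipodal x y -> x != y.
Proof. by move=> /forallP/(_ (inr (Ordinal s1))); apply: contraNneq => ->. Qed.

(* o is the minimum of the down-set that remains on the side of x, or after the
   contraction, in direction k. *)
Lemma antipodal_center x y k : antipodal x y ->
  exists o : delete [set x; y], [/\ code (val o) k = code x k,
    forall i b, inl (i, b) != k -> code (val o) (inl (i, b)) = false &
    forall j, inr j != k -> code (val o) (inr j) = ~~ code x (inr j)].
Proof.
move=> axy; pose c : {ffun key r s -> bool} :=
  [ffun m => if m == k then code x k else if m is inr j then ~~ code x (inr j) else false].
have ck : c k = code x k by rewrite ffunE eqxx.
have cl i b : inl (i, b) != k -> c (inl (i, b)) = false by rewrite ffunE => /negbTE->.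
have cr j : inr j != k -> c (inr j) = ~~ code x (inr j) by rewrite ffunE => /negbTE->.
have [|||o oE] := @in_delete _ _ x y c; last by exists o; rewrite oE.
- apply/forallP => i; have [e|/cl->//] := eqVneq (inl (i, true)) k.
  rewrite [X in _ && X]cl ?andbF // -e (inj_eq inl_inj) xpair_eqE andbF.
  by [].
- have cx := antipodal_corner axy.
  have [[j jk]|[i ik]] : (exists j, inr j != k) \/ (exists i, forall b, inl (i,
    b) != k).
    case: k {c ck cl cr} => [ib|j]; first by left; exists (Ordinal s1).
    have [r0|r0] := posnP r; last by right; exists (Ordinal r0).
    have s2 : 1 < s by lia.
    left; have [->|e] := eqVneq j (Ordinal s1); first by exists (Ordinal s2).
    by exists (Ordinal s1); rewrite eq_sym (inj_eq inr_inj).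
  + by apply/eqP => /(congr1 (fun c : {ffun key r s -> bool} => c (inr j)));
    rewrite cr //; case: (code x _).
  have [b xib] := cornerP _ cx i.
  by apply: contraTneq xib => <-; rewrite cl.
- by apply: contraTneq (forallP axy k) => <-; rewrite ck eqxx.
Qed.

Lemma antipodal_flip_valid x y k (o v : delete [set x; y]) l :
  (forall i b, inl (i, b) != k -> code (val o) (inl (i, b)) = false) ->
  l != k -> code (val v) l != code (val o) l -> valid (flip l (code (val v))).
Proof.
case: l => [[i b]|j] oP lk vol; last by rewrite valid_flip_r ?valid_code.
rewrite valid_unflip ?valid_code //; move: vol; rewrite oP //.
by case: (code _ _).
Qed.

(** Away from [k], a flip towards [o] in a [P_3] direction turns a tip off and leaves a middle
    vertex, so it cannot land on a corner. *)
Lemma antipodal_flip_eq x y z k (o v : delete [set x; y]) l : corner z ->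
  (forall i b, inl (i, b) != k -> code (val o) (inl (i, b)) = false) ->
  l != k -> code (val v) l != code (val o) l -> flip l (code (val v)) = code z ->
  exists2 j, l = inr j & code z (inr j) = code (val o) (inr j).
Proof.
move=> cz oP lk vol e; have vE : code (val v) = flip l (code z) by rewrite -e flipK.
case: l vol e lk vE => [[i b]|j] vol e lk vE; last first.
  exists j => //; move: vol; rewrite vE flip_at.
  by case: (code z _); case: (code _ _).
have := corner_flip (i := i) (b := b) cz; rewrite -vE valid_code => /(_ isT) zk.
by move: vol; rewrite vE flip_at zk oP.
Qed.

(** The antipode [y] lies in the other halfspace, so only [x] has to be avoided. Away from [k] the
    centre is opposite to [x] in every [Q_s] coordinate, so no flip towards it lands on [x]. *)
Lemma antipodal_restriction x y (a b : delete [set x; y]) k : antipodal x y ->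
  code (val b) = flip k (code (val a)) -> code x k = code (val a) k ->
  daisy_cube (restriction a b).
Proof.
move=> axy abE xk; have isoxy := antipodal_iso axy; have ed := embeds_delete isoxy.
have [o [ok ol or]] := antipodal_center k axy.
have oH : o \in halfspace a b by apply/(halfspaceP ed abE); rewrite ok.
apply: (star_center_daisy (embeds_restriction ed abE) (o := Sub o oH)) => v l.
rewrite SubK => vol.
have vk : code (val (val v)) k = code (val a) k by apply: (halfspaceP ed abE) (valP v).
have lk : l != k by apply: contraNneq vol => ->; rewrite vk ok xk.
have [||||u uE] := @restriction_delete x y a b k (flip l (code (val (val v)))) isoxy abE; last by exists u.
- exact: (antipodal_flip_valid ol lk vol).
- apply/eqP => /(antipodal_flip_eq (antipodal_corner axy) ol lk vol)[j lE].
  by rewrite or -?lE // lE; case: (code x _).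
- apply: contraTneq (forallP axy k) => <-.
  by rewrite flip_neq ?vk ?xk ?eqxx // eq_sym.
by rewrite flip_neq // eq_sym.
Qed.

(** Of the two antipodes one has coordinate [k] off, and it may be called [x]. A flip landing on [y]
    is then redirected to [flip k (code y)], which has the same image in the contraction and is
    valid because it turns [k] off. *)
Lemma antipodal_contraction x y (a b : delete [set x; y]) k : antipodal x y ->
  code (val b) = flip k (code (val a)) -> code x k = false ->
  daisy_cube (contraction a b).
Proof.
move=> axy abE xk; have isoxy := antipodal_iso axy; have ed := embeds_delete isoxy.
have [o [ok ol or]] := antipodal_center k axy.
apply: (star_center_daisy (embeds_contraction ed abE) (o := to_blob a b o)).
apply/(star_center_contraction ed abE) => v l lk vol.
have vf := antipodal_flip_valid ol lk vol.
have nx : flip l (code (val v)) != code x.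
  apply/eqP => /(antipodal_flip_eq (antipodal_corner axy) ol lk vol)[j lE].
  by rewrite or -?lE // lE; case: (code x _).
have [e|ny] := eqVneq (flip l (code (val v))) (code y); last first.
  by have [w wE] := in_delete vf nx ny; exists w => m _; rewrite wE.
have yk : code y k by have := forallP axy k; rewrite xk; case: (code y k).
have [|||w wE] := @in_delete _ _ x y (flip k (code y)).
- by rewrite valid_unflip ?valid_code.
- have [m mk] : exists m, m != k.
    by exists l.
  apply: contraTneq (forallP axy m) => <-.
  by rewrite flip_neq ?eqxx.
- exact: flip_neq_self.
by exists w => m mk; rewrite wE e flip_neq.
Qed.

Lemma antipodal_OD x y : antipodal x y -> in_OD (delete [set x; y]).
Proof.
move=> axy; have isoxy := antipodal_iso axy; have ed := embeds_delete isoxy.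
have rs : 1 < r + s by lia.
have xy := antipodal_neq axy; have ayx : antipodal y x by rewrite antipodalC.
apply: (in_OD_one_step ed).
  by move/(daisy_delete rs xy isoxy); apply/negP/antipodal_not_daisy.
move=> a b k abE; split.
  have [e|e] := eqVneq (code x k) (code (val a) k);
    first exact: (antipodal_restriction axy abE).
  have {e} : code y k = code (val a) k.
    by move: e (forallP axy k); case: (code x k); case: (code y k); case: (code _ k).
  by move: a b abE; rewrite setUC => a b abE; apply: antipodal_restriction.
have [e|/negbTE e] := boolP (code x k); last exact: (antipodal_contraction axy abE).
have {e} : code y k = false.
  by move: e (forallP axy k); case: (code x k); case: (code y k).
by move: a b abE; rewrite setUC => a b abE; apply: antipodal_contraction.
Qed.
End Antipodal.

(** Here the deletion has four vertices, so every restriction or contraction has at most three and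
    is a daisy cube. *)
Lemma spike_OD x y : (r, s) = (1, 1) -> spike x y -> in_OD (delete [set x; y]).
Proof.
move=> rs11 spk; have isoxy : iso_pair x y by rewrite /iso_pair spk orbT.
have ed := embeds_delete isoxy; have rs : 1 < r + s by case: rs11 => -> ->.
have nx := spike_mid spk; have [cy _] := spikeP _ _ spk.
have xy : x != y by apply: contraNneq nx => ->.
have card4 : #|delete [set x; y]| = 4.
  have c6 : 3 ^ r * 2 ^ s = 6 by case: rs11 => -> ->.
  have := cardsC [set x; y]; rewrite cards2 xy card_B c6 => -[c4].
  by rewrite card_sig; exact: c4.
apply: (in_OD_one_step ed).
  by move/(daisy_delete rs xy isoxy)/and3P => [cx]; rewrite cx in nx.
move=> a b k abE; split; apply: small_partial_cube_daisy.
- have aH : a \in halfspace a b by apply/(halfspaceP ed abE).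
  by apply/card_gt0P; exists (Sub a aH : restriction a b).
- by rewrite -ltnS -card4; apply: (card_restriction ed abE).
- exact: embeds_partial_cube (embeds_restriction ed abE).
- by apply/card_gt0P; exists (to_blob a b a).
- by rewrite -ltnS -card4; apply: (card_contraction ed abE).
- exact: embeds_partial_cube (embeds_contraction ed abE).
Qed.

Lemma in_OD_delete x y : 1 < r + s -> x != y -> iso_pair x y ->
  in_OD (delete [set x; y]) <->
  [&& antipodal x y, 0 < s & 2 < 2 * r + s] ||
  ((r, s) == (1, 1)) && (spike x y || spike y x).
Proof.
move=> rs xy isoxy; split=> [od|]; last first.
  case/orP => [/and3P[axy s1 rs3]|/andP[/eqP rs11 /orP[spk|spk]]].
  - exact: antipodal_OD.
  - exact: spike_OD.
  - by rewrite setUC; apply: spike_OD.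
case/or3P: (isoxy) => [/and3P[cx cy tw]|spk|spk]; last 2 first.
- rewrite spk orTb andbT; apply/orP; right; apply: contraT => rs11.
  by case: (spike_not_OD spk rs rs11).
- rewrite spk orbT andbT; apply/orP; right; apply: contraT => rs11.
  by move: od; rewrite setUC => od; case: (spike_not_OD spk rs rs11).
have nd : ~~ daisy_pair x y.
  by apply/negP => /(daisy_pair_daisy rs xy); case: od.
have [axy|naxy] := boolP (antipodal x y);
  last by case: (corners_not_OD cx cy isoxy nd naxy).
have s1 : 0 < s.
  rewrite lt0n; apply: contra nd => /eqP s0; rewrite /daisy_pair cx cy /=.
  apply/orP; left; apply/eqP/ffunP => j; have := ltn_ord j; rewrite {2}s0.
  by [].
(* Failure of the bound leaves only [Q_2], whose antipodal pairs are not [iso_pair]s. *)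
rewrite s1 /=; apply/orP; left; rewrite ltnNge; apply: contra tw => rs3.
have [r0 s2] : r = 0 /\ s = 2 by lia.
apply/andP; split.
  by apply/eqP/ffunP => i; have := ltn_ord i; rewrite {2}r0.
apply/eqP; rewrite (_ : qdiff x y = setT) ?cardsT ?card_ord //.
by apply/setP => j; rewrite !inE -!codeE2 (forallP axy).
Qed.
End PairsMinimal.

(** * Products with at least four factors *)

Section Connectivity.
Variables r s : nat.
Implicit Types c d e : {ffun key r s -> bool}.

Definition factor : finType := ('I_r + 'I_s)%type.
Definition factor_of (k : key r s) : factor :=
  match k with inl ib => inl ib.1 | inr j => inr j end.

(** Whole factors are exchanged: taking over a single coordinate of a [P_3] could produce an invalid
    vector. *)
Definition mix (l : factor) c d : {ffun key r s -> bool} :=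
  [ffun m => if factor_of m == l then d m else c m].

Definition differ c d := [set l | [exists m, (factor_of m == l) && (c m != d m)]].

Lemma differP c d l : reflect (exists2 m,
  factor_of m = l & c m != d m) (l \in differ c d).
Proof.
rewrite inE; apply: (iffP existsP) => [[m /andP[/eqP]]|[m lE cd]]; first by exists m.
by exists m; rewrite lE eqxx.
Qed.

Lemma differN c d m : factor_of m \notin differ c d -> c m = d m.
Proof. by move=> mN; apply/eqP; apply: contraNT mN => cd; apply/differP;
  exists m. Qed.

Lemma differ_mix l c d : differ (mix l c d) d = differ c d :\ l.
Proof.
apply/setP => l'; rewrite !inE; have [->|ll] := eqVneq l' l.
  by apply/existsP => -[m /andP[/eqP ml]]; rewrite ffunE ml !eqxx.
apply: eq_existsb => m; have [ml|//] := eqVneq (factor_of m) l'.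
by rewrite ffunE ml (negbTE ll).
Qed.

Lemma valid_mix l c d : valid c -> valid d -> valid (mix l c d).
Proof.
move=> /forallP vc /forallP vd; apply/forallP => i; rewrite !ffunE /=.
by case: ifP.
Qed.

Lemma valid_flip_agree m c d : (forall m',
  factor_of m' = factor_of m -> c m' = d m') ->
  valid c -> valid d -> valid (flip m c) -> valid (flip m d).
Proof.
case: m => [[i b]|j] cd vc vd; last by rewrite !valid_flip_r.
by rewrite !valid_flip_l // !cd.
Qed.

Lemma valid_move c l : valid c -> exists2 m, factor_of m = l & valid (flip m c).
Proof.
move=> vc; case: l => [i|j]; last by exists (inr j) => //; rewrite valid_flip_r.
have [ci|/negbTE ci] := boolP (c (inl (i, true))).
  by exists (inl (i, true)) => //; apply: valid_unflip.
by exists (inl (i, false)) => //; rewrite valid_flip_l // ci orbT.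
Qed.

Lemma avoid_factors (A : seq factor) : size A < r + s -> exists l, l \notin A.
Proof.
move=> ltA; apply/existsP; rewrite -negb_forall; apply/negP => /forallP all.
have : #|[set: factor]| <= #|A| by apply/subset_leq_card/subsetP => l _; exact: all.
by rewrite cardsT card_sum !card_ord leqNgt (leq_ltn_trans (card_size A) ltA).
Qed.

(* Deleting two vertices from a product of at least three factors leaves it
   connected; h stands for an arbitrary function constant along the edges. *)
Variables (T : Type) (h : {ffun key r s -> bool} -> T) (l0 : factor).
Variables (p q : {ffun key r s -> bool}).

(** For a [P_3] factor this is the middle layer, so every edge in either of its two directions has
    exactly one end here. *)
Definition slice c := valid c && [forall m, (factor_of m == l0) ==> ~~ c m].
Let free c := (c != p) && (c != q).

Hypothesis big : 3 < r + s.
Hypothesis h_edge : forall c m, factor_of m != l0 -> slice c -> slice (flip m c) ->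
  free c -> free (flip m c) -> h c = h (flip m c).

Lemma slice_valid c : slice c -> valid c. Proof. by case/andP. Qed.

Lemma slice_flip c m : slice c -> factor_of m != l0 -> valid (flip m c) ->
  slice (flip m c).
Proof.
case/andP => vc /forallP sc ml vm; rewrite /slice vm; apply/forallP => m'.
apply/implyP => /eqP m'l; rewrite flip_neq; first by apply: (implyP (sc m'));
  apply/eqP.
by apply: contraNneq ml => <-; rewrite m'l.
Qed.

Lemma slice_mix l c d : slice c -> slice d -> slice (mix l c d).
Proof.
case/andP => vc /forallP sc /andP[vd /forallP sd]; rewrite /slice valid_mix //=.
apply/forallP => m; rewrite ffunE; case: ifP => _; [exact: sd|exact: sc].
Qed.

Lemma line_connected l c d : slice c -> slice d -> l != l0 ->
  (forall m, factor_of m != l -> c m = d m) ->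
  (forall e, slice e -> (forall m, factor_of m != l -> e m = c m) -> free e) ->
  h c = h d.
Proof.
have [n] := ubnP (ham c d); elim: n c => // n IH c;
  rewrite ltnS => le_n sc sd ll cd fr.
have [->//|ncd] := eqVneq c d.
have : decode c != decode d.
  by apply: contra_neq ncd => /(congr1 (@code _ _)); rewrite !decodeK ?slice_valid.
case/(emb_step (embeds_code r s)) => m [w []];
  rewrite !decodeK ?slice_valid // => cdm wE.
have ml : factor_of m = l by apply/eqP; apply: contraTT cdm => /cd ->; rewrite negbK.
have ml0 : factor_of m != l0 by rewrite ml.
have sm : slice (flip m c) by apply: slice_flip => //; rewrite -wE valid_code.
have off m' : factor_of m' != l -> flip m c m' = c m'.
  by move=> m'l; rewrite flip_neq //; apply: contraNneq m'l => ->; rewrite ml.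
rewrite (h_edge ml0 sc sm); [|exact: fr|exact: fr].
apply: IH => //.
- by apply: leq_trans le_n; rewrite ham_flip_lt.
- by move=> m' m'l; rewrite off // cd.
- by move=> e se eE; apply: fr => // m' m'l; rewrite eE // off.
Qed.

(** If the fibre through [c] and [d] meets [p] or [q], a parallel one is used. Moves in two further
    factors give three disjoint fibres in all, and two vertices cannot meet each of them; this uses
    four factors, counting [l0] and [l]. *)
Lemma factor_connected l c d : slice c -> slice d -> free c -> free d -> l != l0 ->
  (forall m, factor_of m != l -> c m = d m) -> h c = h d.
Proof.
move=> sc sd fc fd ll cd.
pose line e0 e := [forall m, (factor_of m != l) ==> (e m == e0 m)].
have lineP e0 e : reflect (forall m, factor_of m != l -> e m = e0 m) (line e0 e).
  apply: (iffP forallP) => h1 m; first by move=> ml; apply/eqP;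
    apply: (implyP (h1 m)).
  by apply/implyP => /h1->.
pose busy e0 := line e0 p || line e0 q.
have busyN e0 : ~~ busy e0 -> forall e, slice e ->
    (forall m, factor_of m != l -> e m = e0 m) -> free e.
  rewrite negb_or => /andP[np nq] e _ /lineP eE.
  by rewrite /free; apply/andP; split;
    [apply: contraNneq np|apply: contraNneq nq] => <-.
have [b0|/busyN f0] := boolP (busy c); last exact: (line_connected sc sd ll).
have [j1] := @avoid_factors [:: l0; l] (ltnW big).
have [j2] := @avoid_factors [:: l0; l; j1] big.
rewrite !inE !negb_or => /and3P[j2l0 j2l j21] /andP[j1l0 j1l].
have [m1 m1E v1] := valid_move j1 (slice_valid sc).
have [m2 m2E v2] := valid_move j2 (slice_valid sc).
have m12 : m1 != m2 by apply: contraNneq j21 => e; rewrite -m1E -m2E e.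
have detour m j : factor_of m = j -> j != l0 -> j != l -> valid (flip m c) ->
    ~~ busy (flip m c) -> h c = h d.
  move=> mE jl0 jl vm /busyN fm.
  have vmd : valid (flip m d).
    apply: valid_flip_agree vm; rewrite ?slice_valid // => m' m'E.
    by apply: cd; rewrite m'E mE.
  have sm : slice (flip m c) by apply: slice_flip; rewrite ?mE.
  have smd : slice (flip m d) by apply: slice_flip; rewrite ?mE.
  have cdm m' : factor_of m' != l -> flip m d m' = flip m c m'.
    by move=> m'l; rewrite !flipE cd.
  have ml0 : factor_of m != l0 by rewrite mE.
  have f1 : free (flip m c) by apply: fm.
  have f2 : free (flip m d) by apply: fm.
  rewrite (h_edge ml0 sc sm fc f1) (h_edge ml0 sd smd fd f2).
  by apply: (line_connected sm smd ll) => // m' m'l; rewrite cdm.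
have [b1|] := boolP (busy (flip m1 c)); last exact: (detour m1 j1).
have [b2|] := boolP (busy (flip m2 c)); last exact: (detour m2 j2).
have disj e1 e2 m e : factor_of m != l -> e1 m != e2 m -> line e1 e -> line e2 e ->
  False.
  by move=> ml e12 /lineP/(_ m ml) e1E /lineP/(_ m ml) e2E;
    rewrite -e1E e2E eqxx in e12.
have d01 e := @disj c (flip m1 c) m1 e.
have d02 e := @disj c (flip m2 c) m2 e.
have d12 e := @disj (flip m1 c) (flip m2 c) m1 e.
exfalso; case/orP: b0 => b0; case/orP: b1 => b1; case/orP: b2 => b2.
all: try by apply: (d01 _ _ _ b0 b1); rewrite ?m1E // flip_at; case: (c m1).
all: try by apply: (d02 _ _ _ b0 b2); rewrite ?m2E // flip_at; case: (c m2).
all: by apply: (d12 _ _ _ b1 b2); rewrite ?m1E // flip_at flip_neq //; case: (c m1).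
Qed.

(** The factors where [c] and [d] differ are exchanged one at a time. If two first exchanges are
    blocked, they are exactly [p] and [q], and an exchange in any third differing factor is free. *)
Lemma slice_connected c d : slice c -> slice d -> free c -> free d -> h c = h d.
Proof.
have [n] := ubnP #|differ c d|; elim: n c d => // n IH c d;
  rewrite ltnS => le_n sc sd fc fd.
have dl0 : l0 \notin differ c d.
  apply/differP => -[m mE]; have := (forallP (proj2 (andP sc)) m,
    forallP (proj2 (andP sd)) m).
  by rewrite mE eqxx /= => -[/negbTE-> /negbTE->].
have [D0|[l1 l1D]] := set_0Vmem (differ c d).
  by congr h; apply/ffunP => m; apply: differN; rewrite D0 inE.
have offmix l e e' m : factor_of m != l -> mix l e e' m = e m.
  by rewrite ffunE => /negbTE->.
have lD l : l \in differ c d -> l != l0 by move=> h1; apply: contraNneq dl0 => <-.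
have to_mix l c1 d1 : l \in differ c d -> slice c1 -> slice d1 -> free c1 ->
    free (mix l c1 d1) -> h c1 = h (mix l c1 d1).
  move=> h1 sc1 sd1 fc1 fm; apply: (@factor_connected l) => //;
    [exact: slice_mix|exact: lD|].
  by move=> m ml; rewrite offmix.
have lt_mix l c1 d1 : l \in differ c d -> differ c1 d1 = differ c d ->
    #|differ (mix l c1 d1) d1| < n.
  by move=> h1 h2; apply: leq_trans le_n;
    rewrite differ_mix h2 [X in _ < X](cardsD1 l) h1.
have via l : l \in differ c d -> free (mix l c d) -> h c = h d.
  move=> h1 fm; rewrite (to_mix l c d) //; apply: IH => //; first exact: lt_mix.
  exact: slice_mix.
have [/via|nf1] := boolP (free (mix l1 c d)); first exact.
have [D1|[l2 /setD1P[l21 l2D]]] := set_0Vmem (differ c d :\ l1).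
  have dE : mix l1 c d = d.
    by apply/ffunP => m; apply: differN; rewrite differ_mix D1 inE.
  by rewrite dE fd in nf1.
have [/via|nf2] := boolP (free (mix l2 c d)); first exact.
have mix_inj l l' : l \in differ c d -> l != l' -> mix l c d != mix l' c d.
  case/differP => m mE cdm ll; apply: contraNneq cdm => /ffunP/(_ m).
  by rewrite !ffunE mE eqxx (negbTE ll) => ->.
have two l : l \in differ c d -> l != l1 -> l != l2 -> free (mix l c d).
  move=> lDD ll1 ll2; have := mix_inj _ _ lDD ll1; have := mix_inj _ _ lDD ll2.
  have := mix_inj _ _ l2D l21.
  move: nf1 nf2; rewrite /free !negb_and !negbK.
  by move=> /orP[/eqP->|/eqP->] /orP[/eqP->|/eqP->]; rewrite ?eqxx // => _ -> ->.
have [j] := @avoid_factors [:: l0; l1; l2] big.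
rewrite !inE !negb_or => /and3P[jl0 jl1 jl2].
have [jD|jD] := boolP (j \in differ c d); first exact: (via j jD (two j jD jl1 jl2)).
(* The ends agree in factor [j], so both are shifted along it. Everything off the original layer is
   free, because both blocked vertices lie in that layer. *)
have [m mE vm] := valid_move j (slice_valid sc).
have agree m' : factor_of m' = j -> c m' = d m' by move=> m'E; apply: differN;
  rewrite m'E.
have vmd : valid (flip m d).
  by apply: valid_flip_agree vm; rewrite ?slice_valid // => m' m'E; apply: agree;
    rewrite m'E mE.
have sm : slice (flip m c) by apply: slice_flip; rewrite ?mE.
have smd : slice (flip m d) by apply: slice_flip; rewrite ?mE.
have freeN e : e m != c m -> free e.
  have pq : [set p; q] = [set mix l1 c d; mix l2 c d].
    move: nf1 nf2; rewrite /free !negb_and !negbK => /orP[/eqP e1|/eqP e1] /orP[/eqP e2|/eqP e2].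
    - by have := mix_inj _ _ l2D l21; rewrite e1 e2 eqxx.
    - by rewrite e1 e2.
    - by rewrite e1 e2 setUC.
    - by have := mix_inj _ _ l2D l21; rewrite e1 e2 eqxx.
  move=> em; have : e \notin [set p; q].
    rewrite pq !inE negb_or; apply/andP; split; apply: contraNneq em => ->.
      by rewrite offmix // mE.
    by rewrite offmix // mE.
  by rewrite !inE negb_or.
have fm : free (flip m c) by apply: freeN; rewrite flip_at; case: (c m).
have fmd : free (flip m d) by apply: freeN; rewrite flip_at -agree //; case: (c m).
have ml0 : factor_of m != l0 by rewrite mE.
rewrite (h_edge ml0 sc sm fc fm) (h_edge ml0 sd smd fd fmd).
have dE : differ (flip m c) (flip m d) = differ c d.
  apply/setP => l; rewrite !inE; apply: eq_existsb => m'.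
  by rewrite !flipE (inj_eq (@addbI _)).
have fmix : free (mix l1 (flip m c) (flip m d)).
  by apply: freeN; rewrite offmix ?mE // flip_at; case: (c m).
rewrite (to_mix l1 (flip m c) (flip m d)) //.
apply: IH => //; first exact: lt_mix.
exact: slice_mix.
Qed.
End Connectivity.

(** The two routes from [u] to [v'] flip the same coordinates but begin differently, since
    [u' != v]; hence the first flip of one is the second of the other. *)
Lemma embeds_square (I : finType) (G : sgraph) (f : G -> {ffun I ->
  bool}) (u u' v v' : G) :
  embeds f -> adj u u' -> adj v v' -> adj u v -> adj u' v' -> u != v' -> u' != v ->
  forall i, f u i (+) f u' i = f v i (+) f v' i.
Proof.
move=> ef uu vv uv uv' n1 n2.
have [a aE] := (emb_adj ef u u').1 uu; have [d dE] := (emb_adj ef v v').1 vv.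
have [b bE] := (emb_adj ef u v).1 uv; have [c cE] := (emb_adj ef u' v').1 uv'.
have ab : a != b by apply: contraNneq n2 => e; apply/eqP/(emb_inj ef);
  rewrite aE bE e.
have bd : b != d.
  by apply: contraNneq n1 => e; apply/eqP/(emb_inj ef); rewrite dE bE e flipK.
have ad : a = d.
  apply/eqP; apply: contraT => ad;
    have := congr1 (fun z : {ffun I -> bool} => z a) dE.
  rewrite cE aE bE !flipE eqxx (negbTE ab) (negbTE ad).
  have [e|_] := eqVneq a c; last by case: (f u a).
  have := congr1 (fun z : {ffun I -> bool} => z b) dE.
  rewrite cE aE bE !flipE eqxx (negbTE bd) [b == a]eq_sym (negbTE ab) -e [b == a]eq_sym (negbTE ab).
  by case: (f u b).
move=> i; rewrite aE dE bE ad !flipE.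
by case: (i == d) (i == b) (f u i) => [] [] [].
Qed.

Section LargeDimension.
Variables r s : nat.
Hypothesis big : 3 < r + s.
Variables x y : B r s.
Let G := delete [set x; y].
Variables (I : finType) (f : G -> {ffun I -> bool}).
Hypothesis ef : embeds f.

(** Transports [f] to vectors, so that the connectivity of slices applies as stated; vectors that
    code no surviving vertex get a default value. *)
Let F (c : {ffun key r s -> bool}) : {ffun I -> bool} :=
  if [pick u : G | code (val u) == c] is Some u then f u else [ffun => false].

Lemma F_code (u : G) : F (code (val u)) = f u.
Proof.
rewrite /F; case: pickP => [v /eqP/(@code_inj _ _)/val_inj->//|/(_ u)].
by rewrite eqxx.
Qed.

Let label k c : {ffun I -> bool} := [ffun i => F c i (+) F (flip k c) i].
(** The lower end of the [k]-edge at [z]. The edge starting at [c] in the slice survives iff [c] is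
    neither [hit k x] nor [hit k y], so at most two vertices of the slice are lost. *)
Let hit k (z : B r s) := if code z k then flip k (code z) else code z.

Lemma slice_false (k : key r s) c : slice (factor_of k) c -> c k = false.
Proof. by case/andP => _ /forallP/(_ k); rewrite eqxx => /negbTE. Qed.

Lemma slice_valid_flip (k : key r s) c : slice (factor_of k) c -> valid (flip k c).
Proof.
case/andP => vc /forallP sc; case: k sc => [[i b]|j] sc; last by rewrite valid_flip_r.
rewrite valid_flip_l //; have := sc (inl (i, ~~ b)).
by rewrite eqxx /= => ->; rewrite orbT.
Qed.

Lemma valid_slice (k : key r s) c : valid c -> valid (flip k c) -> c k = false ->
  slice (factor_of k) c.
Proof.
move=> vc vk ck; rewrite /slice vc; apply/forallP => m; apply/implyP => /eqP.
case: k m vk ck => [[i b]|j] [[i' b']|j'] //= vk ck [] ii; last by rewrite ii ck.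
rewrite ii; move: vk; rewrite valid_flip_l // ck /=.
by case: (b) (b') ck => [] [] //= ->.
Qed.

Lemma hitN k z (c : {ffun key r s -> bool}) : c k = false ->
  (c != hit k z) = (c != code z) && (flip k c != code z).
Proof.
move=> ck; rewrite /hit; case: ifP => zk; last first.
  suff -> : flip k c != code z by rewrite andbT.
  by apply: contraFneq zk => <-; rewrite flip_at ck.
rewrite -(inj_eq (@flip_inj _ k) c) flipK.
suff -> : c != code z by [].
by apply: contraTneq zk => <-; rewrite ck.
Qed.

Lemma in_slice k c : slice (factor_of k) c -> (c != hit k x) && (c != hit k y) ->
  (exists u : G, code (val u) = c) /\ (exists u : G, code (val u) = flip k c).
Proof.
move=> sc; have ck := slice_false sc; rewrite !hitN //.
move=> /andP[/andP[cx fx] /andP[cy fy]]; split; apply: in_delete => //.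
  exact: (slice_valid sc).
exact: slice_valid_flip.
Qed.

Lemma label_const k c d : slice (factor_of k) c -> slice (factor_of k) d ->
  (c != hit k x) && (c != hit k y) -> (d != hit k x) && (d != hit k y) ->
  label k c = label k d.
Proof.
move=> sc0 sd0 fc0 fd0; apply: (slice_connected (p := hit k x) (q :=
  hit k y) big _ sc0 sd0 fc0 fd0) => {sc0 sd0 fc0 fd0 d}c m mk sc sm fc fm.
have [[u uE] [u' u'E]] := in_slice sc fc.
have [[v vE] [v' v'E]] := in_slice sm fm.
have km : k != m by apply: contraNneq mk => ->.
have adjG (a b : G) l : code (val b) = flip l (code (val a)) -> adj a b.
  by move=> e; rewrite induced_adj; apply/(emb_adj (embeds_code r s)); exists l.
apply/ffunP => i; rewrite !ffunE -v'E -vE -u'E -uE !F_code.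
apply: (embeds_square ef).
- by apply: (adjG _ _ k); rewrite u'E uE.
- by apply: (adjG _ _ k); rewrite v'E vE.
- by apply: (adjG _ _ m); rewrite vE uE.
- by apply: (adjG _ _ m); rewrite v'E u'E flipC.
- apply/eqP => /(congr1 (fun w : G => code (val w) k)).
  by rewrite uE v'E flip_at flip_neq //; case: (c k).
- apply/eqP => /(congr1 (fun w : G => code (val w) k)).
  by rewrite u'E vE flip_at flip_neq //; case: (c k).
Qed.

Let lambda k : {ffun I -> bool} :=
  if [pick c | [&& slice (factor_of k) c, c != hit k x & c != hit k y]] is Some c
  then label k c else [ffun => false].

Lemma lambda_le1 k i j : lambda k i -> lambda k j -> i = j.
Proof.
rewrite /lambda; case: pickP => [c /andP[sc fc]|_]; last by rewrite ffunE.
have [[u uE] [v vE]] := in_slice sc fc.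
rewrite !ffunE -vE -uE !F_code.
have : adj u v by rewrite induced_adj; apply/(emb_adj (embeds_code r s)); exists k;
  rewrite vE uE.
case/(emb_adj ef) => a ->; rewrite !flipE.
have [->|_] := eqVneq i a; last by case: (f u i).
by have [->|_] := eqVneq j a; last by case: (f u j).
Qed.

Lemma edge_lambda (u v : G) k : code (val v) = flip k (code (val u)) ->
  forall i, f u i (+) f v i = lambda k i.
Proof.
wlog uk : u v / code (val u) k = false.
  move=> IH vE i; have [uk|/negbTE uk] := boolP (code (val u) k); last exact: IH.
  by rewrite addbC; apply: IH; rewrite vE ?flip_at ?uk ?flipK.
move=> vE i; have [vu ux uy] := out_delete u; have [vv vx vy] := out_delete v.
have sc : slice (factor_of k) (code (val u)) by apply: valid_slice; rewrite // -vE.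
have fc : (code (val u) != hit k x) && (code (val u) != hit k y).
  by rewrite !hitN // -vE ux uy vx.
rewrite /lambda; case: pickP => [c /andP[sd fd]|/(_ (code (val u)))];
  last by rewrite sc fc.
by rewrite (label_const sd sc fd fc) ffunE -vE !F_code.
Qed.

(* Along a path the labels of repeated directions cancel, so f u and f v differ in
   at most as many coordinates as the codes of u and v. *)
Lemma path_lambda (u v : G) i :
  f u i (+) f v i =
  \big[addb/false]_k ((code (val u) k (+) code (val v) k) && lambda k i).
Proof.
have /connectP[p pp ->] := emb_connect ef u v; elim: p u pp => [|w p IH] u /=.
  by rewrite addbb big1 // => k _; rewrite addbb.
case/andP => uw /IH e; have [k wE] : exists k, code (val w) = flip k (code (val u)).
  by apply/(emb_adj (embeds_code r s)); rewrite -induced_adj.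
have -> : f u i (+) f (last w p) i = (f u i (+) f w i) (+) (f w i (+) f (last w p) i).
  by case: (f u i); case: (f w i); case: (f (last w p) i).
rewrite (edge_lambda wE) e (bigD1 k) // [RHS](bigD1 k) //= addbA; congr (_ (+) _).
  by rewrite wE flip_at; case: (code (val u) k); case: (code _ k); case: (lambda k i).
by apply: eq_bigr => m mk; rewrite wE flip_neq.
Qed.

Lemma isometric_large : isometric G.
Proof.
move=> u v; rewrite /edist (emb_connect ef) (emb_connect (embeds_code r s)).
congr Some; apply/eqP; rewrite eqn_leq; apply/andP; split; last first.
  have [p pp [lp <-]] := dist_walk (emb_connect ef u v).
  rewrite -(size_map val); apply: (@dist_le (B r s)); last by rewrite last_map lp.
  by apply: homo_path pp => a b; rewrite induced_adj.
rewrite (emb_distE ef) (emb_distE (embeds_code r s)).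
(* Each direction of the product changes at most one coordinate of [f]. By [path_lambda] every
   coordinate separating [f u] from [f v] is changed by a direction separating the codes, so [e]
   covers them all. *)
pose e k := [pick i | lambda k i].
rewrite /ham -(card_imset _ (@Some_inj _)); apply: leq_trans (leq_imset_card e _).
apply/subset_leq_card/subsetP => _ /imsetP[i uvi ->]; rewrite inE in uvi.
have /existsP[k /andP[uvk ki]] : [exists k,
  (code (val u) k != code (val v) k) && lambda k i].
  apply: contraT; rewrite negb_exists => /forallP none; move: uvi.
  have := path_lambda u v i; rewrite big1 => [|k _]; last first.
    by have := none k; case: (code (val u) k); case: (code _ k); case: (lambda k i).
  by case: (f u i); case: (f v i).
apply/imsetP; exists k; first by rewrite inE.
rewrite /e; case: pickP => [j kj|/(_ i)]; last by rewrite ki.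
by rewrite (lambda_le1 ki kj).
Qed.
End LargeDimension.

(** * Verified computation for at most three factors *)

(** Only Hamming distances enter, which makes the criterion computable. The strict decrease rules
    out two vertices with equal labels, and hence missing edges. *)
Lemma embeds_of_ham (I : finType) (G : sgraph) (f : G -> {ffun I -> bool}) :
  (forall u v, adj u v -> ham (f u) (f v) = 1) ->
  (forall u v, u != v -> exists2 w, adj u w & ham (f w) (f v) < ham (f u) (f v)) ->
  embeds f.
Proof.
move=> f1 fstep; have step u v : u != v -> exists k w,
    [/\ adj u w, f u k != f v k & f w = flip k (f u)].
  case/fstep => w uw lt; have /ham1P[k kE] : ham (f u) (f w) == 1 by rewrite f1.
  by exists k, w; split=> //; rewrite -ham_flip_lt -kE.
split=> u v; last by case/step => k [w [_ uvk wE]]; exists k, w.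
split=> [/f1/eqP/ham1P//|[k kE]].
have uv : u != v.
  by apply: contraNneq (flip_neq_self k (f u)) => uv; rewrite -kE uv.
have [l [w [uw]]] := step u v uv; rewrite kE flipE.
have [->|_] := eqVneq l k; last by rewrite eqxx.
move=> _; rewrite -kE => fwv.
suff -> : v = w by [].
apply/eqP; apply: contraT; rewrite eq_sym => /fstep[z _].
by rewrite fwv ham0 ltn0.
Qed.

(* Vertices are indices into tables.  A list s of booleans stands for the
   vertex of the cube whose i-th coordinate is [nth false s i]. *)

Fixpoint lham (s t : bitseq) : nat :=
  match s, t with
  | a :: s', b :: t' => (if eqb a b then 0 else 1) + lham s' t'
  | _, _ => 0
  end.

(* Unlike has and all, these do not evaluate the tail when the head decides. *)
Fixpoint lazy_has T (p : T -> bool) (s : seq T) : bool :=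
  if s is x :: s' then if p x then true else lazy_has p s' else false.
Definition lazy_all T (p : T -> bool) (s : seq T) : bool :=
  ~~ lazy_has (fun x => ~~ p x) s.

Lemma lazy_hasE T p (s : seq T) : lazy_has p s = has p s.
Proof. by elim: s => //= x s ->; case: (p x). Qed.
Lemma lazy_allE T p (s : seq T) : lazy_all p s = all p s.
Proof. by rewrite /lazy_all lazy_hasE -all_predC; apply: eq_all => x;
  rewrite /= negbK. Qed.

Lemma lham_map (T : Type) (f g : T -> bool) (e : seq T) :
  lham (map f e) (map g e) = count (fun k => f k != g k) e.
Proof. by elim: e => //= x e ->; case: (f x); case: (g x). Qed.

Lemma count_enum (I : finType) (P : pred I) (e : seq I) :
  perm_eq e (enum I) -> count P e = #|[set i | P i]|.
Proof.
move=> /permP->; rewrite cardsE cardE -size_filter; congr size.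
by rewrite enumT /enum_mem; apply: eq_filter.
Qed.

Definition of_bits m (s : bitseq) : {ffun 'I_m -> bool} := [ffun i : 'I_m =>
  nth false s i].

Lemma lham_of_bits m s t : size s = m -> size t = m ->
  lham s t = ham (of_bits m s) (of_bits m t).
Proof.
move=> sm tm; rewrite -{1}(mkseq_nth false s) -{1}(mkseq_nth false t) sm tm.
rewrite lham_map -val_enum_ord count_map count_enum //.
by apply: eq_card => i; rewrite !inE /= !ffunE.
Qed.

(** * Certificates checked on adjacency tables *)

Section Tables.
Variables (al : seq nat) (nb : seq (seq nat)).
Notation nbr v := (nth [::] nb v).

Definition row_ok (a : nat) (d : seq nat) : bool :=
  (nth 0 d a == 0) && lazy_all (fun v =>
    lazy_all (fun w => nth 0 d w <= (nth 0 d v).+1) (nbr v) &&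
    ((v == a) || lazy_has (fun w => nth 0 d v == (nth 0 d w).+1) (nbr v))) al.

Definition closed_by (p : pred nat) : bool :=
  [&& lazy_has p al, lazy_has (fun v => ~~ p v) al &
      lazy_all (fun v => if p v then lazy_all p (nbr v) else true) al].

(** An edge [uv] crossing from the halfspace of [a] to that of [b] must, in a partial cube,
    determine the same two halfspaces as [ab]; the vertex [z] witnesses that it does not. *)
Definition theta_violation (D : seq (seq nat)) : bool :=
  let E := flatten [seq [seq (a, b) | b <- nbr a] | a <- al] in
  let dd a z := nth 0 (nth [::] D a) z in
  lazy_has (fun ab => lazy_has (fun uv =>
    if dd ab.1 uv.1 < dd ab.2 uv.1 then
      if dd ab.2 uv.2 < dd ab.1 uv.2 then
        lazy_has (fun z => (dd ab.1 z < dd ab.2 z) != (dd uv.1 z < dd uv.2 z)) al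
      else false
    else false) E) E.

Definition labels_ok (m : nat) (lab : seq bitseq) : bool :=
  lazy_all (fun u => (size (nth [::] lab u) == m) &&
    lazy_all (fun w => lham (nth [::] lab u) (nth [::] lab w) == 1) (nbr u)) al &&
  lazy_all (fun u => lazy_all (fun v => (u == v) || lazy_has (fun w =>
    lham (nth [::] lab w) (nth [::] lab v) < lham (nth [::] lab u) (nth [::] lab v))
    (nbr u)) al) al.

(** Evaluates [star_center_contraction] on labels, so no contracted graph is built. The first
    conjunct ensures that direction [k] has an edge to contract. *)
Definition no_contraction_center (m : nat) (lab : seq bitseq) (k : nat) : bool :=
  let bit v i := nth false (nth [::] lab v) i in
  lazy_has (fun a => lazy_has (fun b => bit a k != bit b k) (nbr a)) al &&
  lazy_all (fun o => lazy_has (fun v => lazy_has (fun l =>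
    if (l != k) && (bit v l != bit o l) then
      lazy_all (fun w => lazy_has (fun i =>
        (i != k) && (bit w i != (i == l) (+) bit v i)) (iota 0 m)) al
    else false) (iota 0 m)) al) al.

Variables (G : sgraph) (c : G -> nat).
Hypothesis c_inj : injective c.
Hypothesis alP : forall a, reflect (exists v, c v = a) (a \in al).
Hypothesis nbP : forall u v, adj u v = (c v \in nbr (c u)).
Hypothesis nb_al : forall u w, w \in nbr (c u) -> w \in al.

Lemma al_c v : c v \in al. Proof. by apply/alP; exists v. Qed.

Lemma lazy_all_al (p : pred nat) : lazy_all p al -> forall v, p (c v).
Proof. by rewrite lazy_allE => /allP h v; apply: h (al_c v). Qed.

Lemma lazy_has_al (p : pred nat) : lazy_has p al -> exists v, p (c v).
Proof. by rewrite lazy_hasE => /hasP[_ /alP[v <-]]; exists v. Qed.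

Lemma lazy_all_nb (p : pred nat) u : lazy_all p (nbr (c u)) -> forall v,
  adj u v -> p (c v).
Proof. by rewrite lazy_allE => /allP h v; rewrite nbP; apply: h. Qed.

Lemma lazy_has_nb (p : pred nat) u : lazy_has p (nbr (c u)) -> exists2 v,
  adj u v & p (c v).
Proof.
rewrite lazy_hasE => /hasP[w wu pw]; have /alP[v vE] := nb_al wu.
by exists v; rewrite ?nbP vE.
Qed.

Lemma row_okP a d : row_ok (c a) d -> forall v, dist a v = nth 0 d (c v).
Proof.
case/andP => /eqP d0 /lazy_all_al h v.
apply: (proj2 (dist_unique (d := fun v => nth 0 d (c v)) d0 _ _ v)) => [u w uw|w wa].
  by have /andP[/lazy_all_nb hu _] := h u; apply: hu.
have /andP[_ /orP[/eqP/c_inj e|/lazy_has_nb[u wu /eqP]]] := h w.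
  by rewrite e eqxx in wa.
by exists u; rewrite // adj_sym.
Qed.

Lemma closed_by_disconnected (p : pred nat) : closed_by p -> ~ partial_cube G.
Proof.
case/and3P => /lazy_has_al[u pu] /lazy_has_al[v pv] /lazy_all_al h.
case/partial_cube_embeds => n [f ef].
have /connectP[q pq vE] := emb_connect ef u v.
have : p (c (last u q)).
  elim: q u pu pq {vE} => //= w q IH u pu /andP[uw]; apply: IH.
  by have := h u; rewrite pu => /lazy_all_nb; apply.
by rewrite -vE (negbTE pv).
Qed.

Lemma theta_violationP D :
  lazy_all (fun a => row_ok a (nth [::] D a)) al -> theta_violation D ->
  ~ partial_cube G.
Proof.
move=> /lazy_all_al rows viol /partial_cube_embeds[n [f ef]].
have dE a z : nth 0 (nth [::] D (c a)) (c z) = dist a z by rewrite -(row_okP (rows a)).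
have EP ab : ab \in flatten [seq [seq (a, b) | b <- nbr a] | a <- al] ->
    exists a b, ab = (c a, c b) /\ adj a b.
  case/flatten_mapP => _ /alP[a <-] /mapP[w wa ->].
  have /alP[b bE] := nb_al wa; exists a, b; rewrite bE nbP bE; split=> //.
move: viol; rewrite /theta_violation lazy_hasE => /hasP[ab /EP[a [b [-> ab']]] /=].
rewrite lazy_hasE => /hasP[uv /EP[u [v [-> uv']]] /=]; rewrite !dE.
case: ifP => // uW; case: ifP => // vW /lazy_has_al[z]; rewrite !dE.
have [k kE] := (emb_adj ef a b).1 ab'.
have uk : f u k = f a k by apply/(halfspaceP ef kE); rewrite inE.
have vk : f v k <> f a k.
  by move/(halfspaceP ef kE); rewrite inE ltnNge ltnW.
have [l lE] := (emb_adj ef u v).1 uv'.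
have lk : l = k.
  by apply/eqP; apply: contraT => lk; case: vk; rewrite lE flip_neq // eq_sym.
have zW x y e : f y = flip k (f x) -> f x k = e ->
  (dist x z < dist y z) = (f z k == e).
  move=> yE <-; apply/idP/eqP => [zW|/(halfspaceP ef yE)]; last by rewrite inE.
  by apply/(halfspaceP ef yE); rewrite inE.
by rewrite (zW a b (f a k)) // (zW u v (f a k)) ?eqxx // lE lk.
Qed.

Section Labels.
Variables (m : nat) (lab : seq bitseq).
Hypothesis ok : labels_ok m lab.
Let f v := of_bits m (nth [::] lab (c v)).

Lemma labels_step u v : u != v -> exists2 w, adj u w &
  lham (nth [::] lab (c w)) (nth [::] lab (c v)) <
  lham (nth [::] lab (c u)) (nth [::] lab (c v)).
Proof.
have /andP[_ /lazy_all_al h] := ok; have /lazy_all_al/(_ v) := h u.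
by rewrite (inj_eq c_inj) => /orP[->//|/lazy_has_nb].
Qed.

Lemma labels_embeds : embeds f.
Proof.
have /andP[/lazy_all_al h _] := ok.
have hamE u v : ham (f u) (f v) = lham (nth [::] lab (c u)) (nth [::] lab (c v)).
  by rewrite (@lham_of_bits m) //; apply/eqP;
    [have /andP[] := h u|have /andP[] := h v].
apply: embeds_of_ham => u v; rewrite ?hamE.
  by have /andP[_ /lazy_all_nb hu] := h u => /hu/eqP.
by move/labels_step => [w uw lt]; exists w; rewrite ?hamE.
Qed.

Lemma no_contraction_centerP k : k < m -> no_contraction_center m lab k ->
  ~ daisy_cube G /\ ~ in_OD G.
Proof.
move=> km; pose k' := Ordinal km; have ef := labels_embeds.
have fE v i : f v i = nth false (nth [::] lab (c v)) i by rewrite ffunE.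
case/andP => /lazy_has_al[a /lazy_has_nb[b ab abk]] /lazy_all_al noc.
have kE : f b = flip k' (f a).
  have [l lE] := (emb_adj ef a b).1 ab; rewrite lE; congr flip.
  by move: abk; rewrite -(fE a k') -(fE b k') lE flipE; have [->|_] := eqVneq k' l;
    rewrite ?eqxx.
have nd : ~ daisy_cube (contraction a b).
  case/(daisy_star_center (embeds_contraction ef kE)) => o'.
  have [o ->] := to_blobP o'; move/(star_center_contraction ef kE) => so.
  have /lazy_has_al[v] := noc o; rewrite lazy_hasE => /hasP[l];
    rewrite mem_iota => lm.
  pose l' := Ordinal lm; case: ifP => // /andP[lk vol] /lazy_all_al nw.
  have [||w wE] := so v l'; first by rewrite -(inj_eq val_inj).
    by rewrite !fE.
  have := nw w; rewrite lazy_hasE => /hasP[i]; rewrite mem_iota => im /andP[ik].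
  have := wE (Ordinal im); rewrite -(inj_eq val_inj) /= => /(_ ik).
  by rewrite flipE !fE -(inj_eq val_inj) /= => -> /eqP.
split; last exact: not_OD_contraction ef kE nd.
case/(daisy_star_center ef) => o so; apply: nd.
exact: (daisy_contraction ef kE so).
Qed.
End Labels.
End Tables.

(** * Enumeration of the small products and their deletions *)

Fixpoint bitstrings s : seq bitseq :=
  if s is s'.+1 then [seq b :: l | b <- [:: false; true], l <- bitstrings s']
  else [:: [::]].

Fixpoint strings r s : seq bitseq :=
  if r is r'.+1 then
    [seq p ++ l | p <- [:: [:: true; false]; [:: false; false]; [:: false; true]],
                  l <- strings r' s]
  else bitstrings s.

Definition neighbours (V : seq bitseq) : seq (seq nat) :=
  [seq [seq j <- iota 0 (size V) | lham (nth [::] V i) (nth [::] V j) == 1]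
     | i <- iota 0 (size V)].

Definition survivors (n i j : nat) := [seq v <- iota 0 n | (v != i) && (v != j)].
Definition prune (nb : seq (seq nat)) (i j : nat) :=
  [seq [seq w <- row | (w != i) && (w != j)] | row <- nb].

(* The functions bfs and theta_labels only propose distances and labels, which
   row_ok and labels_ok then check. *)
Fixpoint bfs (nb : seq (seq nat)) (inf fuel k : nat) (front : seq nat) (d : seq nat) :=
  if fuel is fuel'.+1 then
    if front is [::] then d else
    let new := undup [seq w <- flatten [seq nth [::] nb v | v <- front]
                      | nth 0 d w == inf] in
    bfs nb inf fuel' k.+1 new (foldl (fun d w => set_nth 0 d w k.+1) d new)
  else d.

Definition distances (nb : seq (seq nat)) (n : nat) : seq (seq nat) :=
  [seq bfs nb n n 0 [:: a] (set_nth 0 (nseq n n) a 0) | a <- iota 0 n].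

Definition theta_labels (al : seq nat) (nb D : seq (seq nat)) (n : nat) : seq bitseq :=
  foldl (fun lab ab =>
      if nth [::] lab ab.1 == nth [::] lab ab.2 then
        let da := nth [::] D ab.1 in let db := nth [::] D ab.2 in
        [seq (nth 0 da z < nth 0 db z) :: nth [::] lab z | z <- iota 0 n]
      else lab)
    (nseq n [::]) (flatten [seq [seq (a, b) | b <- nth [::] nb a] | a <- al]).

(** The original coordinates are tried first: if they still embed, the deletion is isometric. The
    value [n] marks unreachable vertices in [distances], so [d < n] selects one component. [None]
    means undecided, and [tally] checks that it never occurs. *)
Definition verdict (V : seq bitseq) (nbV : seq (seq nat)) (i j : nat) : option bool :=
  let n := size V in
  let al := survivors n i j in
  let nb := prune nbV i j in
  if labels_ok al nb (size (head [::] V)) V then Some true else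
  let D := distances nb n in
  let d := nth [::] D (head 0 al) in
  if closed_by al nb (fun v => nth 0 d v < n) then Some false else
  let lab := theta_labels al nb D n in
  let m := size (nth [::] lab (head 0 al)) in
  if labels_ok al nb m lab then
    if lazy_has (no_contraction_center al nb m lab) (iota 0 m) then Some true else None
  else if lazy_all (fun a => row_ok al nb a (nth [::] D a)) al then
    if theta_violation al nb D then Some false else None
  else None.

Definition verdicts r s : seq (option bool) :=
  let V := strings r s in
  let nb := neighbours V in
  [seq verdict V nb i j | i <- iota 0 (size V), j <- iota 0 i].

Definition tally r s (k : nat) : bool :=
  let v := verdicts r s in
  [&& size (strings r s) == 3 ^ r * 2 ^ s,
      all isSome v & count (fun b => b == Some true) v == k].

Section Bridge.
Variables r s : nat.

Definition keys : seq (key r s) :=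
  [seq inl ib | ib <- [seq (i, b) | i <- enum 'I_r, b <- [:: true; false]]]
  ++ [seq inr j | j <- enum 'I_s].

Definition string (z : B r s) : bitseq := map (code z) keys.

Lemma perm_keys : perm_eq keys (enum (key r s)).
Proof.
apply: uniq_perm; last 1 first.
- move=> k; rewrite mem_enum mem_cat; apply/orP.
  case: k => [[i b]|j]; [left|right]; last by rewrite map_f ?mem_enum.
  apply: map_f.
  by apply/allpairsP; exists (i, b); rewrite mem_enum !inE; case: b.
- have il : injective (@inl ('I_r * bool) 'I_s) by move=> ? ? [].
  have ir : injective (@inr ('I_r * bool) 'I_s) by move=> ? ? [].
  rewrite cat_uniq (map_inj_uniq il) (map_inj_uniq ir) enum_uniq andbT.
  apply/andP; split; last by apply/hasPn => _ /mapP[j _ ->]; apply/mapP => -[].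
  by apply: allpairs_uniq => //; [exact: enum_uniq|move=> [? ?] [? ?]].
- exact: enum_uniq.
Qed.

Lemma lham_string u v : lham (string u) (string v) = ham (code u) (code v).
Proof. by rewrite lham_map count_enum ?perm_keys. Qed.

Lemma bitstringsP (l : bitseq) : l \in bitstrings (size l).
Proof.
by elim: l => //= b l IH; rewrite !mem_cat; case: b; rewrite map_f ?orbT.
Qed.

Lemma string_in z : string z \in strings r s.
Proof.
rewrite /string map_cat -!(map_comp (code z)); set q := map _ (enum 'I_s).
have sq : size q = s by rewrite size_map size_enum_ord.
rewrite -[in strings _ _]sq -[in strings _ _](size_enum_ord r).
elim: (enum 'I_r) => [|i e IH] /=; first exact: bitstringsP.
have := forallP (valid_code z) i.
case e1: (code z (inl (i, true))); case e0: (code z (inl (i, false))) => //= _.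
- by rewrite !mem_cat; apply/orP; left; apply: map_f.
- by rewrite !mem_cat; apply/orP; right; apply/orP; right; rewrite map_f.
- by rewrite !mem_cat; apply/orP; right; apply/orP; left; apply: map_f.
Qed.

Section Index.
Notation V := (strings r s).
Hypothesis sV : size V = 3 ^ r * 2 ^ s.

Definition idx (z : B r s) : nat := index (string z) V.

Lemma idx_lt z : idx z < size V.
Proof. by rewrite index_mem string_in. Qed.

Lemma nth_idx z : nth [::] V (idx z) = string z.
Proof. by rewrite nth_index ?string_in. Qed.

Lemma string_inj : injective string.
Proof.
move=> u v e; apply: code_inj; apply/eqP.
by rewrite -ham_eq0 -lham_string e lham_string ham0.
Qed.

Lemma idx_inj : injective idx.
Proof. by move=> u v e; apply: string_inj; rewrite -!nth_idx e. Qed.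

(** Only membership of each string in the table is proved directly; surjectivity comes from
    comparing cardinalities, which is why [tally] recomputes the size. *)
Lemma idx_onto i : i < size V -> exists z, idx z = i.
Proof.
move=> lti; pose h z : 'I_(size V) := Ordinal (idx_lt z).
have hinj : injective h by move=> u v [/idx_inj].
have /codomP[z zE] : Ordinal lti \in codom h.
  by apply: (inj_card_onto hinj); rewrite card_ord card_B sV.
by exists z; rewrite -[i]/(val (Ordinal lti)) zE.
Qed.

Notation nbV := (neighbours V).

Lemma neighboursP u v : adj u v = (idx v \in nth [::] nbV (idx u)).
Proof.
rewrite /neighbours (nth_map 0) ?size_iota ?idx_lt // nth_iota ?idx_lt // add0n.
rewrite mem_filter mem_iota idx_lt andbT !nth_idx lham_string.
rewrite leq0n andbT; apply/idP/ham1P => [/(emb_adj (embeds_code r s))//|[k kE]].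
by apply/(emb_adj (embeds_code r s)); exists k.
Qed.

Lemma verdictP x y : match verdict V nbV (idx x) (idx y) with
  | Some true => partial_cube (delete [set x; y]) /\
      (isometric (delete [set x; y]) \/
       ~ daisy_cube (delete [set x; y]) /\ ~ in_OD (delete [set x; y]))
  | Some false => ~ partial_cube (delete [set x; y])
  | None => True
  end.
Proof.
set G := delete [set x; y]; rewrite /verdict.
set al := survivors _ _ _; set nb := prune _ _ _.
pose c (u : G) := idx (val u).
have c_inj : injective c by move=> u v /idx_inj/val_inj.
have inG z : z \in ~: [set x; y] = (idx z != idx x) && (idx z != idx y).
  by rewrite !inE negb_or !(inj_eq idx_inj).
have alP a : reflect (exists v, c v = a) (a \in al).
  rewrite mem_filter mem_iota andbC;
    apply: (iffP idP) => [/andP[/idx_onto[z <-]]|[v <-]].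
    by rewrite -inG => zG; exists (Sub z zG).
  by rewrite idx_lt -inG (valP v).
have row v : v < size V -> nth [::] nb v =
    [seq w <- nth [::] nbV v | (w != idx x) && (w != idx y)].
  by move=> ltv; rewrite (nth_map [::]) // size_map size_iota.
have nbP u v : adj u v = (c v \in nth [::] nb (c u)).
  by rewrite induced_adj row ?idx_lt // mem_filter -inG (valP v) neighboursP.
have nb_al u w : w \in nth [::] nb (c u) -> w \in al.
  rewrite row ?idx_lt // !mem_filter => /andP[-> /=].
  by rewrite (nth_map 0) ?size_iota ?idx_lt // mem_filter => /andP[].
case: ifP => [ok|_].
  have iso : isometric G.
    apply/(isometric_induced (embeds_code r s)).
    refine (embeds_induced (embeds_code r s) _) => u v uG vG uv.
    have [w] := labels_step c_inj alP nbP nb_al ok (uv : Sub u uG != Sub v vG :> G).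
    rewrite induced_adj !nth_idx !lham_string => /(emb_adj (embeds_code r s))[k kE].
    by rewrite kE ham_flip_lt; exists k, (val w); rewrite (valP w).
  split; last by left.
  exact: embeds_partial_cube ((isometric_induced (embeds_code r s) _).1 iso).
set D := distances _ _; case: ifP => [dis|_].
  exact: (closed_by_disconnected alP nbP dis).
set lab := theta_labels _ _ _ _; set m := size _; case: ifP => [ok|_].
  case: ifP => //; rewrite lazy_hasE => /hasP[k]; rewrite mem_iota => /= km noc.
  split; first exact: (embeds_partial_cube (labels_embeds c_inj alP nbP nb_al ok)).
  by right; exact: (no_contraction_centerP c_inj alP nbP nb_al ok km noc).
case: ifP => // rows; case: ifP => // viol.
exact: (theta_violationP c_inj alP nbP nb_al rows viol).
Qed.
End Index.
End Bridge.

Definition lower_pairs n : seq (nat * nat) := [seq (i, j) | i <- iota 0 n,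
  j <- iota 0 i].

Lemma mem_lower_pairs n p : (p \in lower_pairs n) = (p.2 < p.1 < n).
Proof.
apply/allpairsPdep/idP => [[i [j []]]|/andP[ji iN]].
  by rewrite !mem_iota /= !add0n => iN ji -> /=; rewrite ji.
by exists p.1, p.2; rewrite !mem_iota /= !add0n ji iN -surjective_pairing.
Qed.

Lemma uniq_lower_pairs n : uniq (lower_pairs n).
Proof.
apply: allpairs_uniq_dep => [|i _|[i j] [i' j'] _ _ [-> ->]] //; exact: iota_uniq.
Qed.

Section CountTally.
Variables (T : finType) (idx : T -> nat) (n : nat).
Hypotheses (idx_inj : injective idx) (idx_lt : forall z, idx z < n).
Hypothesis idx_onto : forall i, i < n -> exists z, idx z = i.

Lemma card_pairs_count (P : pred {set T}) (f : nat -> nat -> bool) :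
  (forall x y, idx y < idx x -> P [set x; y] = f (idx x) (idx y)) ->
  #|[set X : {set T} | (#|X| == 2) && P X]| =
  count (fun p => f p.1 p.2) (lower_pairs n).
Proof.
move=> PE; pose pr (p : nat * nat) : {set T} :=
  [set z | (idx z == p.1) || (idx z == p.2)].
have prE x y : pr (idx x, idx y) = [set x; y].
  by apply/setP => z; rewrite !inE !(inj_eq idx_inj).
have lowP p : p \in lower_pairs n -> exists x y, p = (idx x, idx y) /\ idx y < idx x.
  case: p => i j; rewrite mem_lower_pairs /= => /andP[ji iN].
  have [x xE] := idx_onto iN; have [y yE] := idx_onto (ltn_trans ji iN).
  by exists x, y; rewrite xE yE.
have pr_inj : {in lower_pairs n &, injective pr}.
  move=> p q /lowP[x [y [-> yx]]] /lowP[x' [y' [-> yx']]]; rewrite !prE => e.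
  have : x' \in [set x; y] by rewrite e !inE eqxx.
  have : y' \in [set x; y] by rewrite e !inE eqxx orbT.
  rewrite !inE => /orP[]/eqP ey /orP[]/eqP ex; move: yx'; rewrite ex ey ?ltnn //.
  by rewrite ltnNge ltnW.
have -> : [set X : {set T} | (#|X| == 2) && P X] =
    [set X in map pr [seq p <- lower_pairs n | f p.1 p.2]].
  apply/setP => X; rewrite !inE; apply/andP/mapP =>
    [[/cards2P[x [y [xy XE]]] PX]|[p]].
    wlog yx : x y xy XE / idx y < idx x.
      move=> IH; have [yx|le_xy] := ltnP (idx y) (idx x); first exact: (IH x y).
      apply: (IH y x); rewrite 1?eq_sym // 1?setUC // ltn_neqAle le_xy andbT.
      by rewrite (inj_eq idx_inj).
    exists (idx x, idx y); last by rewrite prE.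
    by rewrite mem_filter mem_lower_pairs /= yx idx_lt -PE // -XE PX.
  rewrite mem_filter => /andP[fp /lowP[x [y [pE yx]]]] ->; rewrite pE prE in fp *.
  have xy : x != y by apply: contraTneq yx => ->; rewrite ltnn.
  by rewrite cards2 xy PE // fp.
rewrite cardsE (card_uniqP _) ?size_map ?size_filter // map_inj_in_uniq.
  exact/filter_uniq/uniq_lower_pairs.
by move=> p q; rewrite !mem_filter => /andP[_ pl] /andP[_ ql]; apply: pr_inj.
Qed.
End CountTally.

Lemma isometric_partial_cube r s (X : {set B r s}) : isometric (delete X) ->
  partial_cube (delete X).
Proof. by move/(isometric_induced (embeds_code r s))/embeds_partial_cube. Qed.

Lemma tallyP r s k : tally r s k -> N_pc r s = k /\
  forall x y : B r s, x != y -> partial_cube (delete [set x; y]) ->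
    isometric (delete [set x; y]) \/
    ~ daisy_cube (delete [set x; y]) /\ ~ in_OD (delete [set x; y]).
Proof.
case/and3P => /eqP sV /allP some /eqP countE.
have vE : verdicts r s = [seq verdict (strings r s) (neighbours (strings r s)) p.1 p.2
    | p <- lower_pairs (size (strings r s))].
  by rewrite map_allpairs.
have idx_lt z : idx z < size (strings r s) := idx_lt z.
have definite (x y : B r s) : idx y < idx x -> exists2 b,
    verdict (strings r s) (neighbours (strings r s)) (idx x) (idx y) = Some b &
    b <-> partial_cube (delete [set x; y]).
  move=> yx; have := verdictP sV x y;
    have : isSome (verdict (strings r s) (neighbours (strings r s)) (idx x) (idx y)).
    apply: some; rewrite vE; apply/mapP; exists (idx x, idx y) => //.
    by rewrite mem_lower_pairs yx idx_lt.
  case: verdict => // -[] _ h; [exists true|exists false] => //; split=> //.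
  by case: h.
split.
  rewrite -countE vE count_map.
  apply: (card_pairs_count (@idx_inj r s) idx_lt (idx_onto sV)
    (f := fun i j => verdict (strings r s) (neighbours (strings r s)) i j == Some true)).
  move=> x y /definite[b -> bP]; apply/idP/eqP => [/boolp.asboolP/bP->//|[bE]].
  by apply/boolp.asboolP/bP; rewrite bE.
move=> x y; wlog yx : x y / idx y < idx x.
  move=> IH xy; have [yx|xy'|/(@idx_inj r s) e] := ltngtP (idx y) (idx x);
    first exact: IH.
    by rewrite setUC; apply: IH; rewrite // eq_sym.
  by rewrite e eqxx in xy.
move=> _ pc; have := verdictP sV x y; have [b -> /iffRL/(_ pc) ->] := definite x y yx.
by case.
Qed.

(** * Counting *)

Lemma card_rel (T : finType) (R : rel T) :
  #|[set p : T * T | R p.1 p.2]| = \sum_x #|[set y | R x y]|.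
Proof.
rewrite -sum1dep_card (eq_bigr (fun x => \sum_(y | R x y) 1)) => [|x _]; last first.
  by rewrite -sum1dep_card.
by rewrite pair_big_dep.
Qed.

(** Sending an ordered pair to its set is two-to-one. Counting ordered pairs turns each formula into
    a sum of degrees and avoids division. *)
Lemma double_card_pairs (T : finType) (P : pred {set T}) (R : rel T) :
  (forall x y, x != y -> P [set x; y] = R x y) ->
  2 * #|[set X : {set T} | (#|X| == 2) && P X]| = \sum_x #|[set y | (x != y) && R x y]|.
Proof.
move=> PR; rewrite -card_rel; pose S := [set X : {set T} | (#|X| == 2) && P X].
pose g (p : T * T) := [set p.1; p.2].
rewrite -[RHS]sum1_card (partition_big g (mem S)) => [|[x y]]; last first.
  by rewrite !inE /= /g /= => /andP[xy]; rewrite cards2 xy PR // => ->.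
rewrite mulnC -/S -sum_nat_const; apply: eq_bigr => X;
  rewrite inE => /andP[/cards2P[x [y [xy XE]]] PX].
rewrite sum1dep_card (_ : [set _ | _] = [set (x, y); (y, x)]).
  by rewrite cards2 xpair_eqE negb_and xy.
have yx : y != x by rewrite eq_sym.
apply/setP => -[a b]; rewrite !inE /g /= XE !xpair_eqE; apply/idP/idP; last first.
  case/orP => /andP[/eqP-> /eqP->]; first by rewrite xy -PR // -XE PX eqxx.
  by rewrite yx -PR // setUC -XE PX eqxx.
case/andP => /andP[ab _] /eqP e.
have : a \in [set x; y] by rewrite -e !inE eqxx.
have : b \in [set x; y] by rewrite -e !inE eqxx orbT.
rewrite !inE => /orP[]/eqP bE /orP[]/eqP aE; rewrite aE bE ?eqxx ?orbT //.
  by rewrite aE bE eqxx in ab.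
by rewrite aE bE eqxx in ab.
Qed.

Section Counts.
Variables r s : nat.
Implicit Types x y z : B r s.

Lemma card_corner : #|[set z : B r s | corner z]| = 2 ^ (r + s).
Proof.
rewrite (_ : [set z | _] = setX [set f | f \in ffun_on (predC1 mid)] [set: {ffun 'I_s -> bool}]).
  by rewrite cardsX cardsE card_ffun_on cardC1 !card_ord cardsT card_ffun card_bool card_ord expnD.
apply/setP => -[z1 z2]; rewrite !inE andbT; apply/forallP/ffun_onP => h i; exact: h.
Qed.

(** The vertices of the fibre of [x] correspond to the sets of coordinates flipped in [Q_s]. *)
Lemma card_qtwin m x : #|[set y | qtwin m x y]| = 'C(s, m).
Proof.
pose t (A : {set 'I_s}) : B r s := (x.1, [ffun j => x.2 j (+) (j \in A)]).
have qt A : qdiff x (t A) = A.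
  by apply/setP => j; rewrite !inE ffunE; case: (x.2 j); case: (j \in A).
rewrite -[in RHS](card_ord s) -card_draws -(card_imset _ (can_inj qt)).
congr #|pred_of_set _|; apply/setP => y; rewrite inE;
  apply/andP/imsetP => [[/eqP xy1 ym]|[A]].
  exists (qdiff x y); first by rewrite inE.
  case: y xy1 ym => y1 y2 /= <- _; congr pair; apply/ffunP => j.
  by rewrite ffunE inE; case: (x.2 j); case: (y2 j).
by rewrite inE => Am ->; rewrite qt.
Qed.

Lemma card_corner_fiber x : #|[set y : B r s | corner y && (x.2 == y.2)]| = 2 ^ r.
Proof.
rewrite (_ : [set y | _] = setX [set f | f \in ffun_on (predC1 mid)] [set x.2]).
  by rewrite cardsX cardsE card_ffun_on cardC1 !card_ord cards1 muln1.
apply/setP => -[z1 z2]; rewrite !inE eq_sym; congr (_ && _).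
Qed.

Lemma card_spike y : corner y -> #|[set x | spike x y]| = r.
Proof.
move=> cy; have inj : injective (fun i => setmid i y).
  move=> i j /(congr1 fst)/ffunP/(_ i); rewrite !ffunE eqxx;
    case: eqP => // _ /esym/eqP.
  by have /forallP/(_ i)/negbTE-> := cy.
rewrite -[RHS]card_ord -cardsT -(card_imset _ inj); apply: eq_card => x;
  rewrite inE /spike cy /=.
by apply/existsP/imsetP => [[i /eqP->]|[i _ ->]]; exists i.
Qed.

Lemma card_antipodal x : corner x -> #|[set y | antipodal x y]| = 1.
Proof.
move=> cx; pose c : {ffun key r s -> bool} := [ffun k => ~~ code x k].
have cE k : c k = ~~ code x k by rewrite [LHS]ffunE.
have vc : valid c.
  apply/forallP => i; have := code_corner i true cx; rewrite !cE /= => ->.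
  by case: (code x _).
apply/eqP/cards1P; exists (decode c); apply/setP => y; rewrite !inE.
rewrite -(inj_eq (@code_inj _ _)) decodeK //.
apply/forallP/eqP => [h|-> k]; last by rewrite cE; case: (code x k).
by apply/ffunP => k; rewrite cE; have := h k; case: (code x k); case: (code y k).
Qed.

Lemma sum_corner m (F : B r s -> nat) :
  (forall x, corner x -> F x = m) -> (forall x, ~~ corner x -> F x = 0) ->
  \sum_x F x = 2 ^ (r + s) * m.
Proof.
move=> Fc F0; rewrite (bigID (@corner r s)) /= [X in _ + X]big1 // addn0.
rewrite (eq_bigr (fun=> m)) // sum_nat_const -card_corner.
by rewrite cardsE.
Qed.

Lemma qtwin_corner m x y : corner x -> qtwin m x y -> corner y.
Proof. by move=> cx /andP[/eqP e _]; rewrite /corner -e. Qed.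

Lemma qtwin_neq m x y : qtwin m.+1 x y -> x != y.
Proof.
move=> /andP[_ /eqP h]; apply/eqP => e; move: h.
by rewrite e (_ : qdiff y y = set0) ?cards0 //; apply/setP => j; rewrite !inE eqxx.
Qed.

Lemma spike_corner x y : spike x y -> ~~ corner x /\ corner y.
Proof. by move=> spk; split; [apply: spike_mid spk|case/spikeP: spk]. Qed.

Lemma spike_neq x y : spike x y || spike y x -> x != y.
Proof. by apply: contraTneq => ->; rewrite orbb;
  apply/negP => /spike_corner[/negP]. Qed.

(** The two orientations exclude each other, as one end of a spike is a corner and the other is not.
    Swapping the ends shows that they contribute equally, and each corner carries [r] spikes. *)
Lemma sum_spike :
  \sum_(x : B r s) #|[set y | spike x y || spike y x]| = 2 * (2 ^ (r + s) * r).
Proof.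
have split2 x : #|[set y | spike x y || spike y x]| =
    #|[set y | spike x y]| + #|[set y | spike y x]|.
  rewrite (_ : [set y | _] = [set y | spike x y] :|: [set y | spike y x]).
    rewrite cardsU (_ : _ :&: _ = set0) ?cards0 ?subn0 //; apply/setP => y; rewrite !inE.
    by apply/negP => /andP[/spike_corner[/negP nx _] /spike_corner[]].
  by apply/setP => y; rewrite !inE.
rewrite (eq_bigr _ (fun x _ => split2 x)) big_split /=.
rewrite -[X in X + _](card_rel (fun x y => spike x y)).
have -> : [set p : B r s * B r s | spike p.1 p.2] =
    [set (p.2, p.1) | p in [set p : B r s * B r s | spike p.2 p.1]].
  apply/setP => -[x y]; rewrite inE; apply/idP/imsetP => [spk|[[x' y'] + [-> ->]]].
    by exists (y, x); rewrite ?inE.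
  by rewrite inE.
rewrite card_imset; last by move=> [? ?] [? ?] [-> ->].
rewrite (card_rel (fun x y => spike y x)) mul2n -addnn.
have fib x : #|[set y : B r s | spike y x]| = if corner x then r else 0.
  case: ifP => cx; first exact: card_spike.
  apply/eqP; rewrite cards_eq0; apply/eqP/setP => y; rewrite !inE.
  by apply/negP => /spikeP[]; rewrite cx.
by congr (_ + _); apply: sum_corner => x cx; rewrite fib ?cx // (negbTE cx).
Qed.

Lemma sum_with_spikes (R : rel (B r s)) :
  (forall x y, R x y -> corner x && corner y) ->
  \sum_x #|[set y | (x != y) && (R x y || (spike x y || spike y x))]| =
  \sum_x #|[set y | (x != y) && R x y]| + 2 * (2 ^ (r + s) * r).
Proof.
move=> Rc; rewrite -sum_spike -big_split; apply: eq_bigr => x _ /=.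
rewrite (_ : [set y | _ && (_ || _)] =
  [set y | (x != y) && R x y] :|: [set y | spike x y || spike y x]).
  rewrite cardsU (_ : _ :&: _ = set0) ?cards0 ?subn0 //; apply/setP => y;
    rewrite !inE.
  apply/negP => /andP[/andP[_ /Rc/andP[cx cy]]].
  by case/orP => /spike_corner[]; rewrite ?cx ?cy.
apply/setP => y; rewrite !inE; have [spk|_] := boolP (spike x y || spike y x).
  by rewrite (spike_neq spk) !orbT.
by rewrite !orbF.
Qed.

Lemma sum_iso_pair : \sum_(x : B r s) #|[set y | (x != y) && iso_pair x y]| =
  2 ^ (r + s) * (2 ^ (r + s) - 1 - 'C(s, 2)) + 2 * (2 ^ (r + s) * r).
Proof.
rewrite sum_with_spikes => [|x y /and3P[-> ->]//]; congr (_ + _).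
apply: sum_corner => x cx; last first.
  apply/eqP; rewrite cards_eq0; apply/eqP/setP => y.
  by rewrite !inE (negbTE cx) andbF.
have -> : [set y | (x != y) && [&& corner x, corner y & ~~ qtwin 2 x y]] =
    [set y | corner y] :\: (x |: [set y | qtwin 2 x y]).
  apply/setP => y; rewrite !inE cx negb_or eq_sym /=.
  by case: (corner y); rewrite ?andbT ?andbF.
rewrite cardsDS; last first.
  apply/subsetP => y; rewrite !inE => /orP[/eqP->//|]; exact: qtwin_corner.
rewrite cardsU1 card_qtwin card_corner inE -subnDA; congr (_ - (_ + _)).
by case: (boolP (qtwin 2 x x)) => // /qtwin_neq; rewrite eqxx.
Qed.

Lemma sum_daisy_pair : \sum_(x : B r s) #|[set y | (x != y) && daisy_pair x y]| =
  2 ^ (r + s) * (2 ^ r - 1 + s).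
Proof.
apply: sum_corner => x cx; last first.
  apply/eqP; rewrite cards_eq0; apply/eqP/setP => y.
  by rewrite !inE /daisy_pair (negbTE cx) andbF.
rewrite (_ : [set y | _] = ([set y : B r s | corner y && (x.2 == y.2)] :\ x)
    :|: [set y | qtwin 1 x y]); last first.
  apply/setP => y; rewrite !inE /daisy_pair cx /= [y == x]eq_sym andbA [_ && corner y]andbC.
  have [qt|_] := boolP (qtwin 1 x y); last by rewrite !orbF andbCA andbA.
  by rewrite !orbT (qtwin_corner cx qt) (qtwin_neq qt).
rewrite cardsU (_ : _ :&: _ = set0) ?cards0 ?subn0.
  rewrite card_qtwin bin1; congr (_ + _); rewrite -(card_corner_fiber x).
  by rewrite (cardsD1 x [set y : B r s | corner y && (x.2 == y.2)]) inE cx eqxx addKn.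
apply/setP => y; rewrite !inE; apply/negP => /andP[/and3P[_ _ /eqP e] /andP[_]].
by rewrite (_ : qdiff x y = set0) ?cards0 //; apply/setP => j; rewrite !inE e eqxx.
Qed.

Lemma sum_antipodal : 0 < s -> \sum_(x : B r s) #|[set y | (x != y) && antipodal x y]| = 2 ^ (r + s).
Proof.
move=> s1; rewrite -[RHS]muln1; apply: sum_corner => x cx.
  rewrite -(card_antipodal cx); apply: eq_card => y; rewrite !inE.
  by have [->|//] := eqVneq x y; apply/esym/negP => /(antipodal_neq s1); rewrite eqxx.
apply/eqP; rewrite cards_eq0; apply/eqP/setP => y; rewrite !inE;
  apply/negP => /andP[_ /antipodal_corner].
by rewrite (negbTE cx).
Qed.
End Counts.

(** * The four formulas *)

Lemma double_count_pairs (G : sgraph) (P : {set G} -> Prop) (R : rel G) :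
  (forall x y, x != y -> P [set x; y] <-> R x y) ->
  2 * count_pairs P = \sum_x #|[set y | (x != y) && R x y]|.
Proof.
move=> PR; apply: double_card_pairs => x y xy.
by apply/boolp.asboolP/idP => /(PR x y xy).
Qed.

(** The cases with at most three factors, apart from [(0, 0)] and [(0, 1)], where the product has
    fewer than three vertices. The constants are the values of [pi_rs]. *)
Lemma tally02 : tally 0 2 4. Proof. by vm_compute. Qed.
Lemma tally10 : tally 1 0 3. Proof. by vm_compute. Qed.
Lemma tally11 : tally 1 1 10. Proof. by vm_compute. Qed.
Lemma tally20 : tally 2 0 32. Proof. by vm_compute. Qed.
Lemma tally03 : tally 0 3 28. Proof. by vm_compute. Qed.
Lemma tally12 : tally 1 2 56. Proof. by vm_compute. Qed.
Lemma tally21 : tally 2 1 73. Proof. by vm_compute. Qed.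
Lemma tally30 : tally 3 0 76. Proof. by vm_compute. Qed.

Lemma partial_cube_large r s (x y : B r s) : 3 < r + s ->
  partial_cube (delete [set x; y]) -> isometric (delete [set x; y]).
Proof. by move=> big /partial_cube_embeds[n [f ef]];
  apply: (isometric_large big ef). Qed.

(** Lets the daisy and the minimal count consider isometric deletions only: the second alternative
    is incompatible with both. *)
Lemma partial_cube_delete r s (x y : B r s) : 1 < r + s -> x != y ->
  partial_cube (delete [set x; y]) -> isometric (delete [set x; y]) \/
  ~ daisy_cube (delete [set x; y]) /\ ~ in_OD (delete [set x; y]).
Proof.
have [big|small] := ltnP 3 (r + s); first by move=> _ _ /(partial_cube_large big);
  left.
move=> rs; suff [k /tallyP[_ h]] : exists k, tally r s k by apply: h.
case: r s rs small {x y} => [|[|[|[|r]]]] [|[|[|[|s]]]] // _ _.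
- by exists 4; apply: tally02.
- by exists 28; apply: tally03.
- by exists 10; apply: tally11.
- by exists 56; apply: tally12.
- by exists 32; apply: tally20.
- by exists 73; apply: tally21.
- by exists 76; apply: tally30.
Qed.

Lemma N_iso_eq r s : 0 < r + s -> N_iso r s = iota_rs r s.
Proof.
move=> rs; apply/eqP; rewrite -(eqn_pmul2l (isT : 0 < 2)); apply/eqP.
rewrite (double_count_pairs (R := @iso_pair r s)) => [|x y _];
  last exact: isometric_delete.
rewrite sum_iso_pair /iota_rs [in RHS]mulnDr [in RHS]mulnBr.
have -> : 2 * 'C(2 ^ (r + s), 2) = 2 ^ (r + s) * (2 ^ (r + s) - 1).
  by rewrite bin2 mul2n halfK; case: (2 ^ (r + s)) => // n; rewrite oddM subn1 /=;
    case: (odd n); rewrite subn0.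
rewrite [2 * (2 ^ (r + s - 1) * _)]mulnA -expnS (_ : (r + s - 1).+1 = r + s);
  last by lia.
by rewrite -mulnBr [r * _]mulnC.
Qed.

Lemma N_dc_eq r s : 1 < r + s -> N_dc r s = kappa_rs r s.
Proof.
move=> rs; apply/eqP; rewrite -(eqn_pmul2l (isT : 0 < 2)); apply/eqP.
rewrite (double_count_pairs (R := @daisy_pair r s)) => [|x y xy]; last first.
  split=> [d|]; last exact: daisy_pair_daisy.
  have [/isometric_delete iso|[]//] :=
    partial_cube_delete rs xy (daisy_partial_cube d).
  exact: daisy_delete.
rewrite sum_daisy_pair /kappa_rs ifN.
  by rewrite mulnA -expnS (_ : (r + s - 1).+1 = r + s) //; lia.
by apply/eqP => -[r1 s0]; rewrite r1 s0 in rs.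
Qed.

Lemma N_min_eq r s : 1 < r + s -> N_min r s = omega_rs r s.
Proof.
move=> rs; apply/eqP; rewrite -(eqn_pmul2l (isT : 0 < 2)); apply/eqP.
rewrite (double_count_pairs (R := fun x y : B r s =>
  [&& antipodal x y, 0 < s & 2 < 2 * r + s] ||
  ((r, s) == (1, 1)) && (spike x y || spike y x))) => [|x y xy]; last first.
  split=> [od|].
    have [pc _ _] := od; have [/isometric_delete iso|[_]//] := partial_cube_delete rs xy pc.
    by apply/(in_OD_delete rs xy iso).
  have [iso|niso] := boolP (iso_pair x y); first by move/(in_OD_delete rs xy iso).
  case/orP => [/and3P[axy s1 rs3]|/andP[_ spk]];
    first by rewrite antipodal_iso in niso.
  by rewrite /iso_pair spk orbT in niso.
rewrite /omega_rs; have [e|n11] := eqVneq (r, s) (1, 1).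
  case: e => r1 s1; subst r s.
  rewrite sum_with_spikes => [|x y /and3P[axy _ _]]; last first.
    by rewrite (antipodal_corner axy) (@antipodal_corner _ _ y x) // antipodalC.
  (* Twice 6, in ordered pairs: four antipodal ones, and eight from the four spikes. *)
  transitivity (2 ^ (1 + 1) + 8); last by [].
  congr (_ + _); rewrite -(@sum_antipodal 1 1 isT).
  by apply: eq_bigr => x _; apply: eq_card => y; rewrite !inE andbT.
rewrite /=; case: ifP => h; last first.
  rewrite big1 // => x _; apply/eqP; rewrite cards_eq0; apply/eqP/setP => y;
    rewrite !inE.
  by rewrite andbF orbF andbF.
case/andP: h => s1 rs3; rewrite -expnS (_ : (r + s - 1).+1 = r + s); last by lia.
rewrite -(@sum_antipodal r s s1); apply: eq_bigr => x _; apply: eq_card => y.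
by rewrite !inE orbF andbT.
Qed.

Lemma N_pc_eq r s : 0 < r + s -> (r, s) != (0, 1) -> N_pc r s = pi_rs r s.
Proof.
move=> rs rs01; have [big|small] := ltnP 3 (r + s).
  have -> : pi_rs r s = iota_rs r s.
    rewrite /pi_rs (_ : r + s == 3 = false) ?gtn_eqF //= addn0.
    by case: r s big {rs rs01} => [|[|[|[|r]]]] [|[|[|s]]] //=; rewrite ?addn0.
  rewrite -N_iso_eq //; apply: eq_card => X; rewrite !inE; apply: andb_id2l.
  case/cards2P => x [y [xy ->]]; apply/boolp.asboolP/boolp.asboolP.
    exact: partial_cube_large.
  exact: isometric_partial_cube.
case: r s rs rs01 small => [|[|[|[|r]]]] [|[|[|[|s]]]] // _ _ _.
- by have [-> _] := tallyP tally02.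
- by have [-> _] := tallyP tally03.
- by have [-> _] := tallyP tally10.
- by have [-> _] := tallyP tally11.
- by have [-> _] := tallyP tally12.
- by have [-> _] := tallyP tally20.
- by have [-> _] := tallyP tally21.
- by have [-> _] := tallyP tally30.
Qed.

(** The case outside the range [1 < r + s]: a single vertex remains, so all three pairs are daisy
    and none is minimal. *)
Lemma daisy_path3 (X : {set B 1 0}) : #|X| == 2 -> daisy_cube (delete X).
Proof.
move=> /eqP cX; have := cardsC X; rewrite cX card_B => -[c1].
have card1 : #|delete X| = 1 by rewrite card_sig; exact: c1.
have all_eq (u v : delete X) : u = v.
  by have /fintype_le1P/(_ u v) : #|delete X| <= 1 by rewrite card1.
apply: small_partial_cube_daisy; rewrite ?card1 //.
apply: (@embeds_partial_cube 'I_0 _ (fun=> [ffun=> false]));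
  apply: embeds_of_ham => u v.
  by rewrite (all_eq u v) adj_irr.
by rewrite (all_eq u v) eqxx.
Qed.

Theorem corollary25 (r s : nat) (hrs : 3 <= 3 ^ r * 2 ^ s) :
  [/\ N_iso r s = iota_rs r s,
      N_pc r s = pi_rs r s,
      N_dc r s = kappa_rs r s
    & N_min r s = omega_rs r s].
Proof.
have [rs rs01] : 0 < r + s /\ (r, s) != (0, 1).
  by case: r s hrs => [|r] [|[|s]] //; rewrite addSn.
have [rs2|small] := ltnP 1 (r + s).
  by split; [exact: N_iso_eq|exact: N_pc_eq|exact: N_dc_eq|exact: N_min_eq].
have [r1 s0] : r = 1 /\ s = 0.
  by case: r s rs rs01 small {hrs} => [|[|r]] [|[|s]].
rewrite {}r1 {}s0 {r s hrs rs rs01 small}; split.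
- exact: N_iso_eq.
- exact: N_pc_eq.
- rewrite /N_dc /count_pairs; transitivity #|[set X : {set B 1 0} | #|X| == 2]|.
    apply: eq_card => X; rewrite !inE; apply: andb_idr => /daisy_path3 dX.
    exact/boolp.asboolP.
  by rewrite card_draws card_B.
apply: eq_card0 => X; rewrite !inE; apply/negP => /andP[/daisy_path3 dX].
by case/boolp.asboolP => _ /(_ dX).
Qed.
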